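(* Let $M$ be a connected $2n$-dimensional manifold with a complex structure $J$. Then the following conditions are equivalent: (i) there exist vector fields $X_1,\dots,X_n,JX_1,\dots,JX_n$ on $M$, linearly independent at every point of $M$, such that $$[X_k,X_l]=-[JX_k,JX_l]\ \text{ for } k<l,\qquad [JX_k,X_l]=J[X_k,X_l]\ \text{ for } k\le l;$$ (ii) there exist $n$ holomorphic vector fields $Z_1,\dots,Z_n$ on $M$ which are linearly independent at every point of $M$ (in other words, $(M,J)$ is complex parallelizable); (iii) there exist $n$ holomorphic $(1,0)$-forms $\alpha_1,\dots,\alpha_n$ on $M$, linearly independent at every point of $M$, such that $d\alpha_i$ is a section of $\Lambda^{2,0}M$ for every $i$; (iv) there exists a complex connection $\nabla$ on $M$ with trivial holonomy whose torsion tensor field $T$ is of type $(2,0)$.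
   Context: A complex structure is an integrable almost complex structure. A complex connection is an affine connection $\nabla$ with $\nabla J=0$. It has trivial holonomy if parallel transport along every loop is the identity. The torsion is $T(X,Y)=\nabla_XY-\nabla_YX-[X,Y]$, and it is of type $(2,0)$ with respect to $J$ if $T(JX,Y)=JT(X,Y)$ for all vector fields $X,Y$. Holomorphic vector fields are holomorphic sections of $T^{1,0}M$, and their linear independence (as well as that of $(1,0)$-forms) is over $\mathbb{C}$. $\Lambda^{p,q}M$ is the bundle of complex forms of type $(p,q)$ with respect to $J$. A complex manifold $(M,J)$ of complex dimension $n$ is complex parallelizable if there exist $n$ holomorphic vector fields linearly independent at every point of $M$. *)

(* Defs.v *)
From HB Require Import structures.
From mathcomp Require Import all_boot all_order all_algebra.
From mathcomp Require Import all_classical all_reals all_analysis.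
From mathcomp.real_closed Require Export complex.
Export Order.TTheory GRing.Theory Num.Theory.
Export numFieldNormedType.Exports.

Set Implicit Arguments.
Unset Strict Implicit.
Unset Printing Implicit Defensive.

Local Open Scope classical_set_scope.
Local Open Scope ring_scope.

Definition lin_indep (K : pzRingType) (V : lmodType K) (I : finType)
    (v : I -> V) : Prop :=
  forall c : I -> K, \sum_i c i *: v i = 0 -> forall i, c i = 0.

Section SmoothMaps.
Context {R : realType} {V W : normedModType R}.

(* [A] is meant to be open and [V] finite-dimensional; then this is the usual
   notion of a map of class C^k on [A]. *)
Fixpoint class_C (k : nat) (f : V -> W) (A : set V) : Prop :=
  if k is k'.+1 then
    (forall x, A x -> differentiable f x) /\
    (forall v, class_C k' (fun x => 'D_v f x) A)
  else forall x, A x -> {for x, continuous f}.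

Definition smooth_at (f : V -> W) (x : V) : Prop :=
  exists A : set V, [/\ open A, A x & forall k, class_C k f A].

End SmoothMaps.

(* [chart_map] and [chart_inv] are total functions; only their restrictions to
   [chart_dom] and to its image are meaningful. *)
Record chart (R : realType) (m : nat) (T : topologicalType) := Chart {
  chart_dom : set T;
  chart_map :> T -> 'rV[R]_m;
  chart_inv : 'rV[R]_m -> T;
  chart_dom_open : open chart_dom;
  chart_im_open : open (chart_map @` chart_dom);
  chart_mapK : forall p, chart_dom p -> chart_inv (chart_map p) = p;
  chart_map_continuous :
    forall p, chart_dom p -> {for p, continuous chart_map};
  chart_inv_continuous :
    forall p, chart_dom p -> {for chart_map p, continuous chart_inv}
}.

Definition smooth_transition (R : realType) (m : nat) (T : topologicalType)
    (c c' : chart R m T) : Prop :=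
  forall p, chart_dom c p -> chart_dom c' p ->
    smooth_at (c' \o chart_inv c) (c p).

Record manifold (R : realType) (m : nat) := Manifold {
  manifold_space :> topologicalType;
  atlas : set (chart R m manifold_space);
  atlas_cover : forall p, exists2 c, atlas c & chart_dom c p;
  atlas_compatible :
    forall c c', atlas c -> atlas c' -> smooth_transition c c';
  manifold_hausdorff : hausdorff_space manifold_space;
  manifold_second_countable : @second_countable manifold_space
}.

(* Membership in the maximal atlas. *)
Definition smooth_chart (R : realType) (m : nat) (M : manifold R m)
    (c : chart R m M) : Prop :=
  forall c', atlas c' -> smooth_transition c c' /\ smooth_transition c' c.

(* Germs at [p] are represented by total functions: [smooth_fun_at f p] says
   that [f] is smooth on some neighbourhood of [p], and nothing is required of
   [f] elsewhere. The same encoding is used for local vector fields. *)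
Definition smooth_fun_at (R : realType) (m : nat) (M : manifold R m)
    (f : M -> R) (p : M) : Prop :=
  forall c : chart R m M, atlas c -> chart_dom c p ->
    smooth_at (f \o chart_inv c) (c p).

Section Tangent.
Context {R : realType} {m : nat} {M : manifold R m}.

(* Tangent vectors are directional derivatives acting on germs of smooth
   functions; they are extended by 0 to the functions which are not smooth
   near [p], so that equality of tangent vectors is Leibniz equality. *)
Definition is_tangent (p : M) (v : (M -> R) -> R) : Prop :=
  (forall f, ~ smooth_fun_at f p -> v f = 0) /\
  (forall c : chart R m M, atlas c -> chart_dom c p ->
     exists w : 'rV[R]_m, forall f, smooth_fun_at f p ->
       v f = 'D_w (f \o chart_inv c) (c p)).

Definition tangent_pred (p : M) : {pred (M -> R) -> R} :=
  fun v => `[< is_tangent p v >].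

Lemma smooth_at_differentiable (V W : normedModType R) (f : V -> W) (x : V) :
  smooth_at f x -> differentiable f x.
Proof. by case=> A [_ Ax /(_ 1%N) [df _]]; exact: df. Qed.

Lemma tangent_submod_closed (p : M) : submod_closed (tangent_pred p).
Proof.
split.
  apply/asboolP; split=> // c ac cp; exists 0 => f sf.
  rewrite deriveE ?linear0 //; exact/smooth_at_differentiable/sf.
move=> a u v /asboolP[u0 uE] /asboolP[v0 vE]; apply/asboolP; split.
  by move=> f sf; rewrite !fctE u0 // v0 // scaler0 addr0.
move=> c ac cp; have [wu wuE] := uE c ac cp; have [wv wvE] := vE c ac cp.
exists (a *: wu + wv) => f sf.
have df : differentiable (f \o chart_inv c) (c p).
  exact/smooth_at_differentiable/sf.
rewrite !fctE wuE // wvE // !deriveE //.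
by rewrite linearD linearZ.
Qed.

HB.instance Definition _ (p : M) :=
  GRing.isSubmodClosed.Build R ((M -> R) -> R) (tangent_pred p)
    (tangent_submod_closed p).

Record tangent (p : M) := Tangent {
  tangent_val :> (M -> R) -> R;
  _ : tangent_val \in tangent_pred p
}.

HB.instance Definition _ (p : M) := [isSub for @tangent_val p].
HB.instance Definition _ (p : M) := [Choice of tangent p by <:].
HB.instance Definition _ (p : M) := [SubChoice_isSubZmodule of tangent p by <:].
HB.instance Definition _ (p : M) := [SubZmodule_isSubLmodule of tangent p by <:].

(* The tangent vector at [p] acting as [D] on the functions smooth near [p],
   if there is one (and 0 otherwise). *)
Definition tangent_of (p : M) (D : (M -> R) -> R) : tangent p :=
  insubd (0 : tangent p)
    (fun f => if `[< smooth_fun_at f p >] then D f else 0).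

End Tangent.
Arguments tangent {R m M} p.

Section VectorFields.
Context {R : realType} {m : nat}.
Implicit Type M : manifold R m.

Definition vfield M := forall p : M, tangent p.

Definition smooth_vfield_at M (X : vfield M) (p : M) : Prop :=
  forall f : M -> R, smooth_fun_at f p -> smooth_fun_at (fun q => X q f) p.

Definition smooth_vfield M (X : vfield M) : Prop :=
  forall p, smooth_vfield_at X p.

Definition lie_bracket M (X Y : vfield M) : vfield M := fun p =>
  tangent_of p (fun f => X p (fun q => Y q f) - Y p (fun q => X q f)).

End VectorFields.

(* (u, v) stands for u + iv. *)
Definition complexification (V : Type) : Type := (V * V)%type.

Section Complexification.
Context {R : realType} (V : lmodType R).

HB.instance Definition _ :=
  GRing.Zmodule.copy (complexification V) (V * V)%type.

Definition cscale (a : R[i]) (z : complexification V) : complexification V :=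
  (complex.Re a *: z.1 - complex.Im a *: z.2,
   complex.Re a *: z.2 + complex.Im a *: z.1).

Fact cscaleA a b z : cscale a (cscale b z) = cscale (a * b) z.
Proof.
case: a b z => [a a'] [b b'] [u v]; rewrite /cscale /=.
congr pair.
- rewrite scalerBl scalerDl !scalerBr !scalerDr !scalerA !opprD.
  by rewrite [X in _ + X = _]addrC addrACA.
- rewrite scalerBl scalerDl !scalerBr !scalerDr !scalerA.
  by rewrite [X in _ + X = _]addrC addrACA.
Qed.

Fact cscale1 : left_id 1 cscale.
Proof.
by case=> u v; rewrite /cscale /= !scale1r !scale0r subr0 addr0.
Qed.

Fact cscaleDr : right_distributive cscale +%R.
Proof.
case=> [a a'] [u v] [u' v']; congr pair; rewrite /= !scalerDr.
- by rewrite opprD addrACA.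
- by rewrite addrACA.
Qed.

Fact cscaleDl z : {morph cscale^~ z : a b / a + b}.
Proof.
case: z => u v [a a'] [b b']; congr pair; rewrite /= !scalerDl.
- by rewrite opprD addrACA.
- by rewrite addrACA.
Qed.

HB.instance Definition _ := GRing.Zmodule_isLmodule.Build R[i]
  (complexification V) cscaleA cscale1 cscaleDr cscaleDl.

End Complexification.

Section ComplexFields.
Context {R : realType} {m : nat}.
Implicit Type M : manifold R m.

Definition ctangent M (p : M) := complexification (tangent p).

(* The value at a complex tangent vector of the differential of a complex
   function. *)
Definition capply M (p : M) (z : ctangent p) (f : M -> R[i]) : R[i] :=
  let f1 q := complex.Re (f q) in
  let f2 q := complex.Im (f q) in
  ((z.1 f1 - z.2 f2) +i* (z.1 f2 + z.2 f1))%C.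

Definition csmooth_fun_at M (f : M -> R[i]) (p : M) : Prop :=
  smooth_fun_at (fun q => complex.Re (f q)) p /\
  smooth_fun_at (fun q => complex.Im (f q)) p.

Definition cvfield M := forall p : M, ctangent p.

Definition csmooth_vfield_at M (Z : cvfield M) (p : M) : Prop :=
  smooth_vfield_at (fun q => (Z q).1) p /\ smooth_vfield_at (fun q => (Z q).2) p.

Definition clie_bracket M (Z W : cvfield M) : cvfield M := fun p =>
  let Z1 q := (Z q).1 in let Z2 q := (Z q).2 in
  let W1 q := (W q).1 in let W2 q := (W q).2 in
  (lie_bracket Z1 W1 p - lie_bracket Z2 W2 p,
   lie_bracket Z1 W2 p + lie_bracket Z2 W1 p).

Definition cform1 M := forall p : M, {linear ctangent p -> R[i]^o}.

(* (dα)(Z, W) = Z(α(W)) - W(α(Z)) - α([Z, W]). *)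
Definition cform1_d M (alpha : cform1 M) (Z W : cvfield M) (p : M) : R[i] :=
  capply (Z p) (fun q => alpha q (W q) : R[i])
  - capply (W p) (fun q => alpha q (Z q) : R[i])
  - alpha p (clie_bracket Z W p).

End ComplexFields.

Record almost_complex (R : realType) (m : nat) (M : manifold R m) :=
  AlmostComplex {
  acs :> forall p : M, {linear tangent p -> tangent p};
  acs_sqr : forall (p : M) (v : tangent p), acs p (acs p v) = - v;
  acs_smooth : forall (X : vfield M) (p : M), smooth_vfield_at X p ->
    smooth_vfield_at (fun q => acs q (X q)) p
}.

Section ComplexStructures.
Context {R : realType} {m : nat} {M : manifold R m} (J : almost_complex M).

Definition Jfield (X : vfield M) : vfield M := fun p => J p (X p).

(* T^{1,0} and T^{0,1}: the eigenspaces of the complex linear extension of J. *)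
Definition Jc (p : M) (z : ctangent p) : ctangent p := (J p z.1, J p z.2).

Definition type10 (p : M) (z : ctangent p) : Prop := Jc z = ('i)%C *: z.
Definition type01 (p : M) (z : ctangent p) : Prop := Jc z = - ('i)%C *: z.

(* Cauchy-Riemann equations at [p]: df o J = i df. *)
Definition cauchy_riemann (f : M -> R[i]) (p : M) : Prop :=
  forall v : tangent p,
    capply ((J p v, 0) : ctangent p) f = ('i)%C * capply ((v, 0) : ctangent p) f.

Definition holomorphic_fun_at (f : M -> R[i]) (p : M) : Prop :=
  csmooth_fun_at f p /\ \forall q \near p, cauchy_riemann f q.

(* α is of type (1,0), resp. dα is of type (2,0), when it vanishes as soon as
   its argument, resp. one of its arguments, is in T^{0,1}. For dα it is enough
   to look at the first argument, and (dα)_p(z, w) is computed with arbitrary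
   extensions of z and w. *)
Definition form_type10 (alpha : cform1 M) : Prop :=
  forall (p : M) (z : ctangent p), type01 z -> alpha p z = 0.

Definition d_type20 (alpha : cform1 M) : Prop :=
  forall (Z W : cvfield M) (p : M),
    csmooth_vfield_at Z p -> csmooth_vfield_at W p ->
    type01 (Z p) -> cform1_d alpha Z W p = 0.

End ComplexStructures.

Section HolomorphicCoordinates.
Context {R : realType} {n : nat} {M : manifold R (n + n)}.
Variable J : almost_complex M.

(* Charts take their values in R^{n+n}, identified with C^n by
   z_j = x_j + i x_{n+j}. *)
Definition zcoord (c : chart R (n + n) M) (j : 'I_n) (p : M) : R[i] :=
  (c p 0 (lshift n j) +i* c p 0 (rshift n j))%C.

Definition holomorphic_chart (c : chart R (n + n) M) : Prop :=
  smooth_chart c /\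
  forall p, chart_dom c p -> forall j, cauchy_riemann J (zcoord c j) p.

Definition integrable_acs : Prop :=
  forall p : M, exists2 c, holomorphic_chart c & chart_dom c p.

(* Writing Z = \sum_j f_j ∂/∂z_j, the coefficients are f_j = dz_j(Z). *)
Definition holomorphic_vfield (Z : cvfield M) : Prop :=
  (forall p, type10 J (Z p)) /\
  (forall (c : chart R (n + n) M) (p : M),
     holomorphic_chart c -> chart_dom c p ->
     forall j, holomorphic_fun_at J (fun q => capply (Z q) (zcoord c j)) p).

(* Locally α = \sum_j f_j dz_j with f_j holomorphic. *)
Definition holomorphic_form (alpha : cform1 M) : Prop :=
  form_type10 J alpha /\
  (forall (c : chart R (n + n) M) (p : M),
     holomorphic_chart c -> chart_dom c p ->
     exists f : 'I_n -> M -> R[i],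
       (forall j, holomorphic_fun_at J (f j) p) /\
       \forall q \near p, forall z : ctangent q,
         alpha q z = \sum_j f j q * capply z (zcoord c j)).

End HolomorphicCoordinates.

(* ∇_v Y is defined for a tangent vector v at p and a vector field Y which is
   smooth near p; no condition is put on its value for other Y. That ∇_v Y only
   depends on the germ of Y at p is a consequence of the Leibniz rule, applied
   to the indicator function of a neighbourhood of p. *)
Record connection (R : realType) (m : nat) (M : manifold R m) := Connection {
  nabla :> forall p : M, tangent p -> vfield M -> tangent p;
  nabla_linear : forall (p : M) (a : R) (u v : tangent p) (Y : vfield M),
    smooth_vfield_at Y p ->
    nabla (a *: u + v) Y = a *: nabla u Y + nabla v Y;
  nabla_add : forall (p : M) (v : tangent p) (Y Z : vfield M),
    smooth_vfield_at Y p -> smooth_vfield_at Z p ->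
    nabla v (fun q => Y q + Z q) = nabla v Y + nabla v Z;
  nabla_leibniz :
    forall (p : M) (v : tangent p) (f : M -> R) (Y : vfield M),
    smooth_fun_at f p -> smooth_vfield_at Y p ->
    nabla v (fun q => f q *: Y q) = v f *: Y p + f p *: nabla v Y;
  nabla_smooth : forall (p : M) (X Y : vfield M),
    smooth_vfield_at X p -> smooth_vfield_at Y p ->
    smooth_vfield_at (fun q => nabla (X q) Y) p
}.

Section Connections.
Context {R : realType} {m : nat} {M : manifold R m}.
Variable D : connection M.

Definition torsion (X Y : vfield M) : vfield M := fun p =>
  D p (X p) Y - D p (Y p) X - lie_bracket X Y p.

Definition complex_connection (J : almost_complex M) : Prop :=
  forall (p : M) (v : tangent p) (Y : vfield M), smooth_vfield_at Y p ->
    D p v (Jfield J Y) = J p (D p v Y).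

Definition torsion_type20 (J : almost_complex M) : Prop :=
  forall (X Y : vfield M) (p : M),
    smooth_vfield_at X p -> smooth_vfield_at Y p ->
    torsion (Jfield J X) Y p = J p (torsion X Y p).

Definition smooth_curve_at (g : R -> M) (t : R) : Prop :=
  {for t, continuous g} /\
  forall c : chart R m M, atlas c -> chart_dom c (g t) -> smooth_at (c \o g) t.

(* A smooth curve on [0, 1] is one which is smooth on a neighbourhood of it. *)
Definition smooth_curve (g : R -> M) : Prop :=
  forall t : R, 0 <= t <= 1 -> smooth_curve_at g t.

Definition velocity (g : R -> M) (t : R) : tangent (g t) :=
  tangent_of (g t) (fun f => derive1 (f \o g) t).

(* The covariant derivative along [g] of the vector field [V] along [g]: if
   V = \sum_i a_i E_i(g) with E_i vector fields on a neighbourhood of g(t), it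
   is \sum_i (a_i' E_i(g) + a_i ∇_{g'} E_i). *)
Definition is_covariant_derivative (g : R -> M) (V : forall t, tangent (g t))
    (t : R) (w : tangent (g t)) : Prop :=
  exists (k : nat) (E : 'I_k -> vfield M) (a : 'I_k -> R -> R),
    [/\ forall i, smooth_vfield_at (E i) (g t),
        forall i, derivable (a i) t 1,
        \forall s \near t, V s = \sum_i a i s *: E i (g s) &
        w = \sum_i (derive1 (a i) t *: E i (g t)
                    + a i t *: D (g t) (velocity g t) (E i))].

Definition parallel_along (g : R -> M) (V : forall t, tangent (g t)) : Prop :=
  forall t : R, 0 <= t <= 1 -> is_covariant_derivative V (0 : tangent (g t)).

(* Piecewise smooth curves are finite concatenations of smooth curves. *)
Fixpoint piecewise_smooth_path (gs : seq (R -> M)) (p q : M) : Prop :=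
  if gs is g :: gs' then
    [/\ smooth_curve g, g 0 = p & piecewise_smooth_path gs' (g 1) q]
  else p = q.

(* The graph of the parallel transport from T_p M to T_q M along a piecewise
   smooth curve. *)
Inductive parallel_transport :
    seq (R -> M) -> forall p q : M, tangent p -> tangent q -> Prop :=
| ParallelNil (p : M) (v : tangent p) : parallel_transport [::] v v
| ParallelCons (g : R -> M) (gs : seq (R -> M)) (q : M)
    (V : forall t, tangent (g t)) (w : tangent q) :
    smooth_curve g -> parallel_along V -> parallel_transport gs (V 1) w ->
    parallel_transport (g :: gs) (V 0) w.

Definition trivial_holonomy : Prop :=
  forall (p : M) (gs : seq (R -> M)), piecewise_smooth_path gs p p ->
    forall u v : tangent p, parallel_transport gs u v <-> u = v.

End Connections.

(* Main.v *)
Require Import Defs.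
From HB Require Import structures.
From mathcomp Require Import all_boot all_order all_algebra.
From mathcomp Require Import all_classical all_reals all_analysis.
From mathcomp Require Import ring lra.
Import Order.TTheory GRing.Theory Num.Theory numFieldNormedType.Exports.

Set Implicit Arguments.
Unset Strict Implicit.
Unset Printing Implicit Defensive.

Local Open Scope classical_set_scope.
Local Open Scope ring_scope.

(** The four conditions describe one object, a global frame of T^{1,0}M: by real
    parts, by its members, by its dual coframe, and by the connection that makes
    it parallel. They are proved in a circle.

    From (i) to (ii), take Z_k = X_k - i J X_k. A holomorphic coordinate z_j
    satisfies the Cauchy-Riemann equations, so deriving it along J X_k multiplies
    its derivative along X_k by i; applying the bracket identities to z_j thus
    turns them into the Cauchy-Riemann equations of the functions X_l(z_j) along
    the X_k, and the X_k span the tangent spaces over C ([frame_component_CR]).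

    From (ii) to (iii), the forms alpha_k which are dual to the Z_k and vanish on
    T^{0,1} have in a chart the form sum_j B_jk dz_j, where B is the inverse of a
    matrix of holomorphic functions ([dual_form_holomorphic]). The differential of
    a holomorphic form, locally sum_j df_j ^ dz_j, is of type (2,0)
    ([holomorphic_form_d_type20]).

    From (iii) to (iv), the coframe identifies each real tangent space with C^n,
    with J acting as i. The connection that derives components,
    alpha_k(nabla_v Y) = v(alpha_k(Y)), is complex; a field along a curve is
    parallel exactly when its components are constant, so the holonomy is trivial;
    and alpha_k maps the torsion to d alpha_k, so that its type is that of
    d alpha_k ([coframe_connection_torsion]).

    From (iv) to (i), transport e_1, ..., e_n, a basis over C of one tangent space,
    along paths to all points. That parallel fields exist along a path follows from
    the hypothesis on loops, applied to the path followed by its reverse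
    ([transported_exists]); the result does not depend on the path, because the
    holonomy is trivial. The fields X_k so obtained are defined point by point, and
    their smoothness is the main difficulty. On segments in a chart the components
    F_j satisfy the equation of parallel transport, so they have derivatives in all
    directions, given by D_v F_j = - sum_(l, i) v_l Gamma_(l, i, j) F_i. A mean
    value estimate on short segments bounds F by its value at one end
    ([linear_system_growth]), which makes F continuous; then F is of class C^1, as
    its directional derivatives are continuous and linear in v, and the equation
    raises the class step by step ([linear_system_smooth]). The X_k and J X_k are
    parallel, so their brackets are the opposites of torsions, and the bracket
    identities express that the torsion is complex bilinear. *)

(** * Maps of class C^k *)

Section Differentiability.
Context {R : realType} {V W : normedModType R}.

Lemma differentiable_of_estimate (f : V -> W) (df : {linear V -> W}) (x : V) :
  continuous df ->
  (forall e : R, 0 < e ->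
     \forall h \near 0, `|f (h + x) - f x - df h| <= e * `|h|) ->
  differentiable f x /\ 'd f x = df :> (V -> W).
Proof.
move=> dfc est.
have E : f \o shift x = cst (f x) + df +o_ 0 id.
  apply/eqaddoP => e e0; near=> h.
  rewrite !fctE /= opprD addrA.
  by near: h; exact: est.
have dE := diff_unique dfc E.
by split=> //; apply/diff_locallyP; rewrite dE.
Unshelve. all: by end_near. Qed.

Lemma near_eq_differentiable (f g : V -> W) (x : V) :
  {near x, f =1 g} -> differentiable f x -> differentiable g x.
Proof.
move=> fg df.
suff [] : differentiable g x /\ 'd g x = 'd f x :> (V -> W) by [].
apply: differentiable_of_estimate; first exact: diff_continuous.
move=> e e0; have /eqaddoP /(_ e e0) := diff_locally df.
move: fg; rewrite (near_shift 0 x) /= subr0 => fg.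
have fgx : f x = g x by have := nbhs_singleton fg; rewrite /= add0r.
apply: filterS2 fg => h /= fgh; rewrite -fgx -[h + x]/(shift x h) /= -fgh.
by rewrite !fctE /= opprD addrA.
Qed.

End Differentiability.

Section ClassC.
Context {R : realType}.
Implicit Types V W : normedModType R.

Lemma class_C_cont V W k (f : V -> W) A x :
  class_C k f A -> A x -> {for x, continuous f}.
Proof.
by case: k => [|k] /= => [|[df _]] Af; [exact: Af|exact/differentiable_continuous/df].
Qed.

Lemma class_C_congr V W k (f g : V -> W) A : open A ->
  (forall x, A x -> f x = g x) -> class_C k f A -> class_C k g A.
Proof.
move=> oA; elim: k f g => [|k IH] f g fg /=.
  move=> fc x Ax; rewrite /prop_for /continuous_at -fg //.
  apply: cvg_trans (fc x Ax); apply: near_eq_cvg.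
  by near=> y; apply: fg; near: y; exact: open_nbhs_nbhs.
have nfg x : A x -> {near x, f =1 g}.
  by move=> Ax; near=> y; apply: fg; near: y; exact: open_nbhs_nbhs.
move=> [df Df]; split=> [x Ax|v]; first exact: near_eq_differentiable (nfg _ Ax) (df x Ax).
by apply: IH (Df v) => x Ax; apply: near_eq_derive; exact: nfg.
Unshelve. all: by end_near. Qed.

Lemma class_CS V W k (f : V -> W) (A B : set V) :
  B `<=` A -> class_C k f A -> class_C k f B.
Proof.
move=> BA; elim: k f => [|k IH] f /=; first by move=> fc x /BA; exact: fc.
by move=> [df Df]; split=> [x /BA|v]; [exact: df|exact: IH].
Qed.

Lemma class_CW V W k (f : V -> W) A : class_C k.+1 f A -> class_C k f A.
Proof.
elim: k f => [|k IH] f [df Df]; first by move=> x /df /differentiable_continuous.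
by split=> // v; exact/IH/Df.
Qed.

Lemma class_C_cst V W k (w : W) (A : set V) : class_C k (fun=> w) A.
Proof.
elim: k w => [|k IH] w /=; first by move=> x _; exact: cst_continuous.
split=> [x _|v]; first exact: differentiable_cst.
suff -> : (fun x => 'D_v (fun=> w) x) = (fun=> (0 : W)) by exact: IH.
by apply/funext => x; rewrite derive_cst.
Qed.

Lemma class_CD V W k (f g : V -> W) A : open A ->
  class_C k f A -> class_C k g A -> class_C k (fun x => f x + g x) A.
Proof.
move=> oA; elim: k f g => [|k IH] f g /=.
  by move=> fc gc x Ax; apply: continuousD; [exact: fc|exact: gc].
move=> [df Df] [dg Dg]; split=> [x Ax|v].
  by apply: differentiableD; [exact: df|exact: dg].
apply: class_C_congr oA _ (IH _ _ (Df v) (Dg v)) => x Ax.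
by rewrite deriveD //; apply: diff_derivable; [exact: df|exact: dg].
Qed.

Lemma class_C_sum V W k (I : Type) (s : seq I) (F : I -> V -> W) A : open A ->
  (forall i, class_C k (F i) A) -> class_C k (fun x => \sum_(i <- s) F i x) A.
Proof.
move=> oA cF; elim: s => [|i s IH].
  by under eq_fun do rewrite big_nil; exact: class_C_cst.
by under eq_fun do rewrite big_cons; exact: class_CD.
Qed.

Lemma class_CM V k (f g : V -> R) A : open A ->
  class_C k f A -> class_C k g A -> class_C k (fun x => f x * g x) A.
Proof.
move=> oA; elim: k f g => [|k IH] f g.
  by move=> fc gc x Ax; apply: continuousM; [exact: fc|exact: gc].
move=> Cf Cg; move: (class_CW Cf) (class_CW Cg) => Wf Wg.
move: Cf Cg => [df Df] [dg Dg]; split=> [x Ax|v].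
  by apply: differentiableM; [exact: df|exact: dg].
apply: class_C_congr oA _
  (class_CD oA (IH _ _ Wf (Dg v)) (IH _ _ Wg (Df v))) => x Ax.
by rewrite deriveM //; apply: diff_derivable; [exact: df|exact: dg].
Qed.

Lemma class_CV V k (f : V -> R) A : open A -> (forall x, A x -> f x != 0) ->
  class_C k f A -> class_C k (fun x => (f x)^-1) A.
Proof.
move=> oA f0; elim: k => [|k IH].
  by move=> fc x Ax; apply: continuousV; [exact: f0|exact: fc].
move=> Cf; have IHf := IH (class_CW Cf); move: Cf => [df Df].
split=> [x Ax|v]; first by apply: differentiableV; [exact: df|exact: f0].
have C : class_C k (fun x => -1 * ((f x)^-1 * (f x)^-1 * 'D_v f x)) A.
  have := class_CM oA (class_CM oA IHf IHf) (Df v).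
  exact: (class_CM oA (class_C_cst k (-1 : R) A)).
apply: (class_C_congr oA _ C) => x Ax.
have -> : 'D_v (fun y => (f y)^-1) x = - (f x) ^- 2 *: 'D_v f x.
  by apply: deriveV; [exact: f0|exact/diff_derivable/df].
by rewrite mulN1r scaleNr expr2 invfM.
Qed.

Lemma class_C_scalel V W k (f : V -> R) (w : W) A : open A ->
  class_C k f A -> class_C k (fun x => f x *: w) A.
Proof.
move=> oA; elim: k f => [|k IH] f /=.
  move=> fc x Ax; exact/continuousZr_tmp/fc.
move=> [df Df]; split=> [x Ax|v].
  by apply: differentiableZl; exact: df.
apply: class_C_congr oA _ (IH _ (Df v)) => x Ax.
rewrite !deriveE ?diffZl //; try exact: df.
by apply: differentiableZl; exact: df.
Qed.

Lemma class_C_coord V m k (f : V -> 'rV[R]_m) A : open A ->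
  class_C k f A <-> forall i, class_C k (fun x => f x 0 i) A.
Proof.
move=> oA; split.
  elim: k f => [|k IH] f /= Cf i.
    move=> x Ax; apply: (@continuous_comp _ _ _ f (fun M : 'rV[R]_m => M 0 i)).
      exact: Cf.
    exact: coord_continuous.
  case: Cf => df Df; split=> [x Ax|v].
    apply: (@differentiable_comp _ _ _ _ f (fun M : 'rV[R]_m => M 0 i)).
      exact: df.
    exact: differentiable_coord.
  apply: class_C_congr oA _ (IH _ (Df v) i) => x Ax.
  rewrite derive_mx ?mxE //; exact/diff_derivable/df.
move=> Cf; have -> : f = (fun x => \sum_i f x 0 i *: delta_mx 0 i).
  by apply/funext => x; rewrite -row_sum_delta.
by apply: class_C_sum => // i; exact: class_C_scalel.
Qed.

Lemma derive_rV_comp V W m (f : V -> 'rV[R]_m) (g : 'rV[R]_m -> W) x v :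
  differentiable f x -> differentiable g (f x) ->
  'D_v (g \o f) x =
    \sum_i 'D_v (fun y => f y 0 i) x *: 'D_(delta_mx 0 i) g (f x).
Proof.
move=> df dg; rewrite deriveE; last exact: differentiable_comp.
rewrite diff_comp //= -(deriveE v df) derive_mx; last exact: diff_derivable.
rewrite (row_sum_delta (\matrix_(_, _) _)) linear_sum; apply: eq_bigr => i _.
by rewrite linearZ mxE (deriveE _ dg).
Qed.

(** By the chain rule the derivatives of g \o f are sums of products of
    derivatives of f with partial derivatives of g composed with f; the
    induction on k applies to the latter. *)
Lemma class_C_comp V m k (f : V -> 'rV[R]_m) (g : 'rV[R]_m -> R) A B :
  open A -> (forall x, A x -> B (f x)) -> class_C k f A -> class_C k g B ->
  class_C k (g \o f) A.
Proof.
move=> oA AB; elim: k g => [|k IH] g Cf Cg.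
  move=> x Ax; apply: continuous_comp; first exact: (class_C_cont Cf).
  exact/(class_C_cont Cg)/AB.
have Wf := class_CW Cf.
have df x : A x -> differentiable f x by case: Cf => df _; exact: df.
have dg x : A x -> differentiable g (f x).
  by case: Cg => dg _ /AB; exact: dg.
split=> [x Ax|v]; first by apply: differentiable_comp; [exact: df|exact: dg].
apply: (@class_C_congr _ _ _ (fun x => \sum_i 'D_v (fun y => f y 0 i) x
   * ('D_(delta_mx 0 i) g \o f) x)) => // [x Ax|].
  by rewrite (derive_rV_comp (g := g)) //; [exact: df|exact: dg].
apply: class_C_sum => // i; apply: class_CM => //.
  by move/(class_C_coord k.+1 f oA) : Cf => /(_ i) [_]; exact.
have [_ Dg] := Cg; exact: (IH _ Wf (Dg (delta_mx 0 i))).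
Qed.

Lemma class_C_id k V (A : set V) : class_C k id A.
Proof.
case: k => [|k]; first by move=> x _; exact: cvg_id.
split=> [x _|v]; first exact: ex_diff.
suff -> : (fun x => 'D_v id x) = (fun=> v) by exact: class_C_cst.
by apply/funext => x; rewrite derive_id.
Qed.

End ClassC.

Section SmoothAt.
Context {R : realType}.
Implicit Types V W : normedModType R.

Lemma smooth_at_near V W (f : V -> W) x :
  smooth_at f x -> \forall y \near x, smooth_at f y.
Proof.
move=> [A [oA Ax CA]]; apply: filterS (open_nbhs_nbhs (conj oA Ax)) => y Ay.
by exists A.
Qed.

Lemma smooth_at_cont V W (f : V -> W) x : smooth_at f x -> {for x, continuous f}.
Proof. by move=> [A [oA Ax CA]]; exact: (class_C_cont (CA 0%N)). Qed.

Lemma smooth_at_congr V W (f g : V -> W) x :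
  {near x, f =1 g} -> smooth_at f x -> smooth_at g x.
Proof.
move=> fg; have : nbhs x (fun y => f y = g y) := fg.
rewrite nbhsE => -[B [oB Bx] {}fg] [A [oA Ax CA]].
have oAB := openI oA oB; exists (A `&` B); split=> // k.
apply: class_C_congr oAB _ (class_CS (@subIsetl _ A B) (CA k)) => y [_ By].
exact: fg.
Qed.

Lemma smooth_at_cst V W (w : W) (x : V) : smooth_at (fun=> w) x.
Proof. by exists setT; split=> // [|k]; [exact: openT|exact: class_C_cst]. Qed.

Lemma smooth_at_id V (x : V) : smooth_at id x.
Proof. by exists setT; split=> // [|k]; [exact: openT|exact: class_C_id]. Qed.

Lemma smooth_atD V W (f g : V -> W) x :
  smooth_at f x -> smooth_at g x -> smooth_at (fun y => f y + g y) x.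
Proof.
move=> [A [oA Ax CA]] [B [oB Bx CB]]; have oAB := openI oA oB.
exists (A `&` B); split=> // k; apply: class_CD => //.
  exact: class_CS (@subIsetl _ A B) (CA k).
exact: class_CS (@subIsetr _ A B) (CB k).
Qed.

Lemma smooth_atM V (f g : V -> R) x :
  smooth_at f x -> smooth_at g x -> smooth_at (fun y => f y * g y) x.
Proof.
move=> [A [oA Ax CA]] [B [oB Bx CB]]; have oAB := openI oA oB.
exists (A `&` B); split=> // k; apply: class_CM => //.
  exact: class_CS (@subIsetl _ A B) (CA k).
exact: class_CS (@subIsetr _ A B) (CB k).
Qed.

Lemma smooth_atV V (f : V -> R) x : f x != 0 ->
  smooth_at f x -> smooth_at (fun y => (f y)^-1) x.
Proof.
move=> f0 [A [oA Ax CA]].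
have : nbhs x (A `&` (fun y => f y != 0)).
  apply: filterI; first exact: open_nbhs_nbhs.
  by have /cvgr_neq0 := class_C_cont (CA 0%N) Ax; exact.
rewrite nbhsE => -[B [oB Bx] BA]; exists B; split=> // k; apply: class_CV => //.
  by move=> y /BA[].
by apply: class_CS (CA k) => y /BA[].
Qed.

Lemma smooth_at_coord V m (f : V -> 'rV[R]_m) x :
  smooth_at f x <-> forall i, smooth_at (fun y => f y 0 i) x.
Proof.
split=> [[A [oA Ax CA]] i|].
  by exists A; split=> // k; exact: (class_C_coord k f oA).1.
move=> sf; have -> : f = (fun x => \sum_i f x 0 i *: delta_mx 0 i).
  by apply/funext => y; rewrite -row_sum_delta.
elim: (index_enum _) => [|i s IH].
  by under eq_fun do rewrite big_nil; exact: smooth_at_cst.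
under eq_fun do rewrite big_cons; apply: smooth_atD => //.
have [A [oA Ax CA]] := sf i; exists A; split=> // k.
exact: class_C_scalel.
Qed.

Lemma smooth_at_comp V m (f : V -> 'rV[R]_m) (g : 'rV[R]_m -> R) x :
  smooth_at f x -> smooth_at g (f x) -> smooth_at (g \o f) x.
Proof.
move=> [A [oA Ax CA]] [B [oB Bx CB]].
have : nbhs x (A `&` f @^-1` B).
  apply: filterI; first exact: open_nbhs_nbhs.
  by apply: (class_C_cont (CA 0%N) Ax); exact: open_nbhs_nbhs.
rewrite nbhsE => -[C [oC Cx] CAB]; exists C; split=> // k.
apply: (class_C_comp (B := B)) => //; first by move=> y /CAB[].
by apply: class_CS (CA k) => y /CAB[].
Qed.

Lemma smooth_at_derive V W (f : V -> W) v x :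
  smooth_at f x -> smooth_at ('D_v f) x.
Proof.
by move=> [A [oA Ax CA]]; exists A; split=> // k; have [_] := CA k.+1; exact.
Qed.

Lemma smooth_at_comp_rV V m n (f : V -> 'rV[R]_m) (g : 'rV[R]_m -> 'rV[R]_n) x :
  smooth_at f x -> smooth_at g (f x) -> smooth_at (g \o f) x.
Proof.
move=> sf /smooth_at_coord sg; apply/smooth_at_coord => i.
exact: (smooth_at_comp (g := fun y => g y 0 i)).
Qed.

End SmoothAt.

(** * Mean value theorem along a direction and mixed second derivatives *)

Lemma half_distance_absurd (R : realFieldType) (a b p : R) :
  `|a - p| < `|a - b| / 2 -> `|b - p| < `|a - b| / 2 -> False.
Proof.
move=> ap bp; have := ler_distD p a b; rewrite (distrC p b) => /le_lt_trans.
by move=> /(_ _ (ltrD ap bp)); rewrite -splitr ltxx.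
Qed.

Section DirectionalMVT.
Context {R : realType} {V : normedModType R}.

Lemma is_derive_lineP (f : V -> R) (x v : V) (t d : R) :
  is_derive t 1 (fun s : R => f (x + s *: v)) d <-> is_derive (x + t *: v) v f d.
Proof.
have E : (fun h : R => h^-1 *: (((fun s : R => f (x + s *: v)) \o shift t) (h *: 1)
      - f (x + t *: v))) =
    (fun h : R => h^-1 *: ((f \o shift (x + t *: v)) (h *: v) - f (x + t *: v))).
  apply/funext => h /=; congr (_ *: (f _ - _)).
  by rewrite [h *: 1]mulr1 scalerDl addrCA.
by split=> -[df dE]; split; move: df dE; rewrite /derivable /derive E.
Qed.

Lemma directional_MVT (f : V -> R) (x v : V) (h : R) : 0 <= h ->
  (forall t, 0 <= t <= h -> derivable f (x + t *: v) v) ->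
  exists2 t, 0 <= t <= h & f (x + h *: v) - f x = h * 'D_v f (x + t *: v).
Proof.
move=> h0 df.
have dg t : t \in `[0, h] ->
    is_derive t 1 (fun s : R => f (x + s *: v)) ('D_v f (x + t *: v)).
  by rewrite in_itv /= => th; apply/is_derive_lineP/derivableP/df.
have cg : {within `[0, h], continuous (fun s : R => f (x + s *: v))}.
  by apply: derivable_within_continuous => t /dg [].
have dg' t : t \in `]0, h[ ->
    is_derive t 1 (fun s : R => f (x + s *: v)) ('D_v f (x + t *: v)).
  by move=> th; apply: dg; exact: subset_itv_oo_cc.
have [t th E] := MVT_segment h0 dg' cg.
exists t; first by rewrite in_itv in th.
by move: E; rewrite scale0r addr0 subr0 mulrC.
Qed.

Lemma near_box (u v x : V) (P : set V) : nbhs x P ->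
  exists2 h : R, 0 < h & forall s t : R, 0 <= s <= h -> 0 <= t <= h ->
    P (x + s *: u + t *: v).
Proof.
move=> /nbhs_normP[e /= e0 eP].
(* 1 is added because u and v may vanish. *)
exists (e / (1 + `|u| + `|v|)).
  by rewrite divr_gt0 // -addrA ltr_pwDl // addr_ge0.
have D0 : 0 < 1 + `|u| + `|v| by rewrite -addrA ltr_pwDl // addr_ge0.
move=> s t /andP[s0 sh] /andP[t0 th]; apply: eP => /=.
rewrite distrC [_ - x]addrAC [x + _]addrC addrK.
apply: (le_lt_trans (ler_normD _ _)); rewrite !normrZ !ger0_norm //.
apply: (@le_lt_trans _ _ (e / (1 + `|u| + `|v|) * (`|u| + `|v|))).
  by rewrite mulrDr lerD // ler_wpM2r.
by rewrite -mulrA gtr_pMr // ltr_pdivrMl // mulr1 -addrA ltrDr.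
Qed.

(** Two mean value theorems: along u, for the difference between a translate of
    f by h *: v and f, then along v, for the derivative of f along u. *)
Lemma second_difference (f : V -> R) (A : set V) (u v x : V) (h : R) : 0 < h ->
  class_C 2 f A ->
  (forall s t : R, 0 <= s <= h -> 0 <= t <= h -> A (x + s *: u + t *: v)) ->
  exists s t : R, [/\ 0 <= s <= h, 0 <= t <= h &
    f (x + h *: u + h *: v) - f (x + h *: u) - (f (x + h *: v) - f x)
    = h * h * 'D_v ('D_u f) (x + s *: u + t *: v)].
Proof.
move=> h0 [df Df] Ax; have h00 : 0 <= h <= h by rewrite lexx ltW.
have z0 : 0 <= (0 : R) <= h by rewrite lexx ltW.
pose g y := f (y + h *: v) - f y.
have dfs s : 0 <= s <= h -> derivable f (x + s *: u) u.
  move=> sh; apply/diff_derivable/df.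
  by have := Ax s 0 sh z0; rewrite scale0r addr0.
have dfhs s : 0 <= s <= h -> derivable (fun y => f (y + h *: v)) (x + s *: u) u
   /\ 'D_u (fun y => f (y + h *: v)) (x + s *: u) = 'D_u f (x + s *: u + h *: v).
  move=> sh.
  have E : (fun k : R => k^-1 *:
      (((fun y => f (y + h *: v)) \o shift (x + s *: u)) (k *: u)
      - f (x + s *: u + h *: v))) =
    (fun k : R => k^-1 *: ((f \o shift (x + s *: u + h *: v)) (k *: u) - f (x + s *: u + h *: v))).
    by apply/funext => k; congr (_ *: (f _ - _)); rewrite /= -addrA.
  have : derivable f (x + s *: u + h *: v) u.
    by apply/diff_derivable/df; exact: Ax.
  by rewrite /derivable /derive E.
have [s sh|s sh E] := @directional_MVT g x u h (ltW h0).
  by apply: derivableB; [exact: (dfhs s sh).1|exact: dfs].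
have [t th|t th E'] := @directional_MVT ('D_u f) (x + s *: u) v h (ltW h0).
  by apply/diff_derivable; have [dDf _] := Df u; apply: dDf; exact: Ax.
exists s, t; split=> //.
rewrite -mulrA -E' -[LHS]/(g (x + h *: u) - g x) E deriveB.
- by rewrite (dfhs s sh).2.
- exact: (dfhs s sh).1.
- exact: dfs.
Qed.

(** The second difference is symmetric in u and v, so both mixed derivatives
    take the same value at points as close to x as wanted, and they are
    continuous. *)
Lemma derive_comm (f : V -> R) (A : set V) (u v x : V) : open A -> A x ->
  class_C 2 f A -> 'D_v ('D_u f) x = 'D_u ('D_v f) x.
Proof.
move=> oA Ax Cf; apply/eqP/negPn/negP => neq.
set a := 'D_v _ _ in neq; set b := 'D_u _ _ in neq.
have e0 : 0 < `|a - b| / 2 by rewrite divr_gt0 // normr_gt0 subr_eq0.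
have ca : {for x, continuous ('D_v ('D_u f))}.
  by apply: (class_C_cont _ Ax (k := 0)); have [_ /(_ u) [_ /(_ v)]] := Cf.
have cb : {for x, continuous ('D_u ('D_v f))}.
  by apply: (class_C_cont _ Ax (k := 0)); have [_ /(_ v) [_ /(_ u)]] := Cf.
have /(near_box u v)[h h0 hP] : nbhs x (fun y => [/\ A y,
    `|a - 'D_v ('D_u f) y| < `|a - b| / 2 & `|b - 'D_u ('D_v f) y| < `|a - b| / 2]).
  have Ha : \forall y \near x, `|a - 'D_v ('D_u f) y| < `|a - b| / 2.
    by move/cvgrPdist_lt : ca; apply.
  have Hb : \forall y \near x, `|b - 'D_u ('D_v f) y| < `|a - b| / 2.
    by move/cvgrPdist_lt : cb; apply.
  by apply: filterS3 (open_nbhs_nbhs (conj oA Ax)) Ha Hb => y.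
have [s [t [sh th E]]] := second_difference h0 Cf (fun s t sh th =>
  let: And3 A _ _ := hP s t sh th in A).
have [|t' [s' [th' sh' E']]] := @second_difference f A v u x h h0 Cf.
  by move=> s1 t1 h1 h2; rewrite addrAC; have [] := hP t1 s1 h2 h1.
have EE : h * h * 'D_v ('D_u f) (x + s *: u + t *: v) =
          h * h * 'D_u ('D_v f) (x + t' *: v + s' *: u).
  have sd (p q r s0 : R) : p - q - (r - s0) = p - r - (q - s0) by ring.
  move: E'; rewrite [x + h *: v + _]addrAC => E'.
  exact: etrans (esym E) (etrans (sd _ _ _ _) E').
have hh : h * h != 0 by rewrite mulf_neq0 ?gt_eqF.
move/(mulfI hh) : EE.
have [_ + _] := hP s t sh th; have [_ _ +] := hP s' t' sh' th'.
rewrite addrAC => Hb Ha EE; rewrite EE in Ha.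
exact: half_distance_absurd Ha Hb.
Qed.

End DirectionalMVT.

(** The mean value theorem on the segment from x to x + h compares f (x + h) - f
    x with the derivative along h at a point of that segment. Since the
    directional derivatives depend linearly on the direction, continuity of the
    coefficients G makes the error small with respect to h; one segment is
    enough, where the criterion with partial derivatives needs a path along the
    axes. *)
Lemma differentiable_of_directional (R : realType) (m : nat) (f : 'rV[R]_m -> R)
    (G : 'I_m -> 'rV[R]_m -> R) (A : set 'rV[R]_m) : open A ->
  (forall i y, A y -> {for y, continuous (G i)}) ->
  (forall y v, A y -> derivable f y v /\ 'D_v f y = \sum_i v 0 i * G i y) ->
  forall x, A x -> differentiable f x.
Proof.
move=> oA cG dfG x Ax.
have lG : linear (fun v : 'rV[R]_m => \sum_i v 0 i * G i x).
  move=> a u v; rewrite scaler_sumr -big_split; apply: eq_bigr => i _.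
  by rewrite !mxE mulrDl -mulrA.
pose dG : {linear 'rV[R]_m -> R} :=
  HB.pack (fun v : 'rV[R]_m => \sum_i v 0 i * G i x)
    (GRing.isLinear.Build R _ _ _ _ lG).
suff [] : differentiable f x /\ 'd f x = dG :> ('rV[R]_m -> R) by [].
apply: differentiable_of_estimate.
  move=> v; apply: (@class_C_cont _ _ _ 0 _ setT) => //=.
  apply: (@class_C_sum _ _ _ 0); first exact: openT.
  move=> i y _; apply: continuousM; last exact: cst_continuous.
  exact: coord_continuous.
move=> e e0.
(* The m terms of the sum share e; m%:R + 1 because m may be 0. *)
have : nbhs x (fun y => A y /\ forall i, `|G i x - G i y| < e / (m%:R + 1)).
  have Gn i : \forall y \near x, `|G i x - G i y| < e / (m%:R + 1).
    by have /cvgrPdist_lt := cG i x Ax; apply; rewrite divr_gt0 // ltr_wpDl.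
  by apply: filterI; [exact: open_nbhs_nbhs|exact: filter_forall Gn].
move=> /nbhs_normP[r /= r0 rP]; apply/nbhs_normP; exists r => // h /=.
rewrite sub0r normrN => hr.
have rt (t : R) : 0 <= t <= 1 -> A (x + t *: h) /\
    forall i, `|G i x - G i (x + t *: h)| < e / (m%:R + 1).
  move=> /andP[t0 t1]; apply: rP => /=; rewrite opprD addrA subrr add0r normrN.
  by rewrite normrZ ger0_norm // (le_lt_trans _ hr) // ler_piMl.
have [t /rt [/dfG dA _]|t /rt [At Gt]] := @directional_MVT _ _ f x h 1 ler01.
  by have [] := dA h.
have [_ ->] := dfG _ h At.
rewrite scale1r mul1r [h + x]addrC => ->.
rewrite -sumrB; apply: (le_trans (ler_norm_sum _ _ _)).
apply: (@le_trans _ _ (\sum_(i < m) `|h| * (e / (m%:R + 1)))).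
  apply: ler_sum => i _; rewrite -mulrBr normrM ler_pM //.
    by rewrite [leRHS]mx_normrE; exact: (le_bigmax _ _ (0, i)).
  by rewrite distrC ltW.
rewrite sumr_const card_ord -mulrnAr [leRHS]mulrC.
apply: ler_wpM2l => //.
rewrite -[leLHS]mulr_natr -mulrA; apply: ler_piMr; first exact: ltW.
by rewrite mulrC ler_pdivrMr ?mul1r ?lerDl // ltr_wpDl.
Qed.

(** * Smooth functions, tangent vectors and vector fields in charts *)

Section SmoothFunctions.
Context {R : realType} {m : nat} {M : manifold R m}.
Implicit Types (c a : chart R m M) (p q : M) (f g : M -> R).

Lemma atlas_smooth_chart c : atlas c -> smooth_chart c.
Proof. by move=> ac c' ac'; split; exact: atlas_compatible. Qed.

Lemma near_chart_invK c p : chart_dom c p ->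
  \forall x \near c p, chart_dom c (chart_inv c x) /\ c (chart_inv c x) = x.
Proof.
move=> cp; have : nbhs (c p) (c @` chart_dom c).
  by apply: open_nbhs_nbhs; split; [exact: chart_im_open|exists p].
by apply: filterS => _ [q cq <-]; rewrite chart_mapK.
Qed.

Lemma near_chart_dom c p : chart_dom c p -> \forall q \near p, chart_dom c q.
Proof. by move=> cp; apply: open_nbhs_nbhs; split=> //; exact: chart_dom_open. Qed.

Lemma near_chart_inv c p (P : set M) : chart_dom c p ->
  (\forall q \near p, P q) -> \forall x \near c p, P (chart_inv c x).
Proof.
move=> cp Pp; apply: (chart_inv_continuous cp).
by rewrite chart_mapK.
Qed.

Lemma near_chart_map c p (P : set 'rV[R]_m) : chart_dom c p ->
  (\forall x \near c p, P x) -> \forall q \near p, P (c q).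
Proof. by move=> cp Pp; exact: (chart_map_continuous cp). Qed.

Lemma chart_inv_change c a p f : chart_dom c p -> chart_dom a p ->
  {near c p, (f \o chart_inv a) \o (a \o chart_inv c) =1 f \o chart_inv c}.
Proof.
move=> cp ap; have := near_chart_inv cp (near_chart_dom ap).
by apply: filterS => x ax /=; rewrite chart_mapK.
Qed.

Lemma smooth_at_change c a p f : chart_dom c p -> chart_dom a p ->
  smooth_transition c a ->
  smooth_at (f \o chart_inv a) (a p) -> smooth_at (f \o chart_inv c) (c p).
Proof.
move=> cp ap tca sf; apply: smooth_at_congr (chart_inv_change f cp ap) _.
by apply: smooth_at_comp; [exact: tca|rewrite /= chart_mapK].
Qed.

(** Passing to another chart is a composition with a smooth transition map. *)
Lemma smooth_fun_chart c p f : smooth_chart c -> chart_dom c p ->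
  smooth_fun_at f p <-> smooth_at (f \o chart_inv c) (c p).
Proof.
move=> sc cp; split=> [sf|sf a aa ap].
  have [a aa ap] := atlas_cover p.
  by apply: (smooth_at_change cp ap); [exact: (sc a aa).1|exact: sf].
by apply: (smooth_at_change ap cp) => //; exact: (sc a aa).2.
Qed.

Lemma smooth_fun_near f p :
  smooth_fun_at f p -> \forall q \near p, smooth_fun_at f q.
Proof.
have [a aa ap] := atlas_cover p; have sa := atlas_smooth_chart aa.
move=> /(smooth_fun_chart f sa ap) /smooth_at_near /(near_chart_map ap).
apply: filterS2 (near_chart_dom ap) => q aq sf.
exact/(smooth_fun_chart f sa aq).
Qed.

Lemma smooth_fun_congr f g p :
  {near p, f =1 g} -> smooth_fun_at f p -> smooth_fun_at g p.
Proof.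
move=> fg sf a aa ap; apply: smooth_at_congr _ (sf a aa ap).
exact: (near_chart_inv ap fg).
Qed.

Lemma smooth_fun_cst (k : R) p : smooth_fun_at (fun=> k) p.
Proof. by move=> a aa ap; exact: smooth_at_cst. Qed.

Lemma smooth_funD f g p : smooth_fun_at f p -> smooth_fun_at g p ->
  smooth_fun_at (fun q => f q + g q) p.
Proof. by move=> sf sg a aa ap; apply: smooth_atD; [exact: sf|exact: sg]. Qed.

Lemma smooth_funM f g p : smooth_fun_at f p -> smooth_fun_at g p ->
  smooth_fun_at (fun q => f q * g q) p.
Proof. by move=> sf sg a aa ap; apply: smooth_atM; [exact: sf|exact: sg]. Qed.

Lemma smooth_funZ (k : R) f p : smooth_fun_at f p ->
  smooth_fun_at (fun q => k * f q) p.
Proof. by apply: smooth_funM; exact: smooth_fun_cst. Qed.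

Lemma smooth_funN f p : smooth_fun_at f p -> smooth_fun_at (fun q => - f q) p.
Proof. by move/(smooth_funZ (-1)); under eq_fun do rewrite mulN1r. Qed.

Lemma smooth_funB f g p : smooth_fun_at f p -> smooth_fun_at g p ->
  smooth_fun_at (fun q => f q - g q) p.
Proof. by move=> sf sg; apply: smooth_funD => //; exact: smooth_funN. Qed.

Lemma smooth_funV f p : f p != 0 -> smooth_fun_at f p ->
  smooth_fun_at (fun q => (f q)^-1) p.
Proof.
move=> f0 sf a aa ap; apply: smooth_atV; last exact: sf.
by rewrite /= chart_mapK.
Qed.

Lemma smooth_fun_sum (I : Type) (s : seq I) (F : I -> M -> R) p :
  (forall i, smooth_fun_at (F i) p) -> smooth_fun_at (fun q => \sum_(i <- s) F i q) p.
Proof.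
move=> sF; elim: s => [|i s IH].
  by under eq_fun do rewrite big_nil; exact: smooth_fun_cst.
by under eq_fun do rewrite big_cons; exact: smooth_funD.
Qed.

Lemma chart_comp_near c p (g : 'rV[R]_m -> R) : chart_dom c p ->
  {near c p, g =1 (g \o c) \o chart_inv c}.
Proof. by move=> /near_chart_invK; apply: filterS => x [_ /= ->]. Qed.

Lemma smooth_fun_comp_chart c p (g : 'rV[R]_m -> R) :
  smooth_chart c -> chart_dom c p -> smooth_at g (c p) ->
  smooth_fun_at (g \o c) p.
Proof.
move=> sc cp sg; apply/(smooth_fun_chart _ sc cp).
exact: smooth_at_congr (chart_comp_near _ cp) sg.
Qed.

Definition chart_coord c (i : 'I_m) : M -> R := fun q => c q 0 i.

Lemma smooth_chart_coord c p i : smooth_chart c -> chart_dom c p ->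
  smooth_fun_at (chart_coord c i) p.
Proof.
move=> sc cp; apply: (smooth_fun_comp_chart (g := fun x => x 0 i)) => //.
exact: ((smooth_at_coord id _).1 (smooth_at_id _)).
Qed.

Lemma smooth_partial c p f i : smooth_chart c -> chart_dom c p ->
  smooth_fun_at f p ->
  smooth_fun_at ('D_(delta_mx 0 i) (f \o chart_inv c) \o c) p.
Proof.
move=> sc cp /(smooth_fun_chart f sc cp) sf.
by apply: smooth_fun_comp_chart => //; exact: smooth_at_derive.
Qed.

End SmoothFunctions.

Section TangentVectors.
Context {R : realType} {m : nat} {M : manifold R m}.
Implicit Types (c a : chart R m M) (p q : M) (f g : M -> R).

Lemma tangentP p (v : tangent p) : is_tangent p v.
Proof. by case: v => v /= /asboolP. Qed.

Lemma tangent_valD p (u v : tangent p) f : (u + v) f = u f + v f.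
Proof. by []. Qed.

Lemma tangent_valN p (u : tangent p) f : (- u) f = - u f.
Proof. by []. Qed.

Lemma tangent_valZ p (k : R) (u : tangent p) f : (k *: u) f = k * u f.
Proof. by []. Qed.

Lemma tangent_val0 p f : (0 : tangent p) f = 0.
Proof. by []. Qed.

Lemma tangent_val_sum p (I : Type) (s : seq I) (F : I -> tangent p) f :
  (\sum_(i <- s) F i) f = \sum_(i <- s) F i f.
Proof.
by elim: s => [|i s IH]; rewrite ?big_nil // !big_cons tangent_valD IH.
Qed.

Lemma tangent_nonsmooth p (v : tangent p) f : ~ smooth_fun_at f p -> v f = 0.
Proof. by have [v0 _] := tangentP v; exact: v0. Qed.

Lemma derive_change c a p f w : smooth_transition c a ->
  chart_dom c p -> chart_dom a p -> smooth_at (f \o chart_inv a) (a p) ->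
  'D_w (f \o chart_inv c) (c p) =
  \sum_i 'D_w (chart_coord a i \o chart_inv c) (c p)
         * 'D_(delta_mx 0 i) (f \o chart_inv a) (a p).
Proof.
move=> tca cp ap sf; rewrite -(near_eq_derive _ (chart_inv_change f cp ap)).
have ac : (a \o chart_inv c) (c p) = a p by rewrite /= chart_mapK.
rewrite derive_rV_comp ?ac //; last exact: smooth_at_differentiable.
exact/smooth_at_differentiable/tca.
Qed.

(** The chain rule; a tangent vector is thus determined by its values on the
    coordinates of one chart of the maximal atlas. *)
Lemma tangent_chartE c p (v : tangent p) f : smooth_chart c -> chart_dom c p ->
  smooth_fun_at f p ->
  v f = \sum_i v (chart_coord c i)
        * 'D_(delta_mx 0 i) (f \o chart_inv c) (c p).
Proof.
move=> sc cp sf; have [a aa ap] := atlas_cover p.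
have [_ /(_ a aa ap)[w vE]] := tangentP v.
rewrite vE // (@derive_change a c) //; last 2 first.
- exact: (sc a aa).2.
- exact/(smooth_fun_chart f sc cp).
by apply: eq_bigr => i _; rewrite vE //; exact: smooth_chart_coord.
Qed.

Lemma tangent_eqP c p (u v : tangent p) : smooth_chart c -> chart_dom c p ->
  (forall i, u (chart_coord c i) = v (chart_coord c i)) -> u = v.
Proof.
move=> sc cp uv; apply/val_inj/funext => f /=.
have [sf|nsf] := pselect (smooth_fun_at f p).
  by rewrite !(tangent_chartE _ sc cp sf); apply: eq_bigr => i _; rewrite uv.
by rewrite !tangent_nonsmooth.
Qed.

(** An operator which is a directional derivative in one chart is one in every
    chart, again by the chain rule, so that tangent_of does not fall back on 0. *)
Lemma tangent_ofE c p (D : (M -> R) -> R) (w : 'rV[R]_m) :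
  smooth_chart c -> chart_dom c p ->
  (forall f, smooth_fun_at f p -> D f = 'D_w (f \o chart_inv c) (c p)) ->
  forall f, smooth_fun_at f p -> tangent_of p D f = D f.
Proof.
move=> sc cp DE f sf; rewrite /tangent_of /insubd insubT /=; last first.
  by move=> ?; rewrite asboolT.
apply/asboolP; split=> [g nsg|a aa ap]; first by rewrite asboolF.
exists (\row_i 'D_w (chart_coord a i \o chart_inv c) (c p)) => g sg.
have sga := sg a aa ap.
rewrite asboolT // DE // (@derive_change c a) //; last exact: (sc a aa).1.
rewrite deriveE; last exact: smooth_at_differentiable.
rewrite (row_sum_delta (\row_i _)) linear_sum; apply: eq_bigr => i _.
rewrite linearZ mxE /=; congr (_ * _).
by rewrite deriveE //; exact: smooth_at_differentiable.
Qed.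

Definition chart_tangent c p (w : 'rV[R]_m) : tangent p :=
  tangent_of p (fun f => 'D_w (f \o chart_inv c) (c p)).

Lemma chart_tangentE c p w f : smooth_chart c -> chart_dom c p ->
  smooth_fun_at f p -> chart_tangent c p w f = 'D_w (f \o chart_inv c) (c p).
Proof. by move=> sc cp sf; exact: (tangent_ofE sc cp (fun _ _ => erefl) sf). Qed.

Lemma chart_tangent_coord c p w i : smooth_chart c -> chart_dom c p ->
  chart_tangent c p w (chart_coord c i) = w 0 i.
Proof.
move=> sc cp; rewrite chart_tangentE //; last exact: smooth_chart_coord.
have E : {near c p, (fun x : 'rV[R]_m => x 0 i) =1 chart_coord c i \o chart_inv c}.
  exact: (chart_comp_near (fun x : 'rV[R]_m => x 0 i) cp).
rewrite -(near_eq_derive _ E).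
have := derive_mx (@derivable_id _ _ (c p) w).
by rewrite derive_id => /rowP /(_ i); rewrite mxE => E'; exact: esym E'.
Qed.

Lemma tangent_congr p (v : tangent p) f g : {near p, f =1 g} -> v f = v g.
Proof.
move=> fg; have [sf|nsf] := pselect (smooth_fun_at f p); last first.
  rewrite !tangent_nonsmooth // => sg; apply: nsf; apply: smooth_fun_congr sg.
  by apply: filterS fg => q /= ->.
have sg := smooth_fun_congr fg sf; have [a aa ap] := atlas_cover p.
have [_ /(_ a aa ap)[w vE]] := tangentP v.
by rewrite !vE //; apply: near_eq_derive; exact: (near_chart_inv ap fg).
Qed.

Lemma tangent_cst p (v : tangent p) (k : R) : v (fun=> k) = 0.
Proof.
have [a aa ap] := atlas_cover p.
have [_ /(_ a aa ap)[w vE]] := tangentP v.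
by rewrite vE ?derive_cst //; exact: smooth_fun_cst.
Qed.

Lemma tangentD p (v : tangent p) f g :
  smooth_fun_at f p -> smooth_fun_at g p ->
  v (fun q => f q + g q) = v f + v g.
Proof.
move=> sf sg; have [a aa ap] := atlas_cover p.
have [_ /(_ a aa ap)[w vE]] := tangentP v.
rewrite !vE //; last exact: smooth_funD.
by apply: deriveD; apply/diff_derivable/smooth_at_differentiable; [exact: sf|exact: sg].
Qed.

Lemma tangentM p (v : tangent p) f g :
  smooth_fun_at f p -> smooth_fun_at g p ->
  v (fun q => f q * g q) = f p * v g + g p * v f.
Proof.
move=> sf sg; have [a aa ap] := atlas_cover p.
have [_ /(_ a aa ap)[w vE]] := tangentP v.
rewrite !vE //; last exact: smooth_funM.
have /deriveM -> : derivable (f \o chart_inv a) (a p) w.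
  exact/diff_derivable/smooth_at_differentiable/sf.
  by rewrite /= chart_mapK.
exact/diff_derivable/smooth_at_differentiable/sg.
Qed.

Lemma tangentZ p (v : tangent p) (k : R) f : smooth_fun_at f p ->
  v (fun q => k * f q) = k * v f.
Proof.
move=> sf; rewrite tangentM //; last exact: smooth_fun_cst.
by rewrite tangent_cst mulr0 addr0.
Qed.

Lemma tangentN p (v : tangent p) f : smooth_fun_at f p ->
  v (fun q => - f q) = - v f.
Proof.
by move=> /(tangentZ v (-1)); rewrite mulN1r; under eq_fun do rewrite mulN1r.
Qed.

Lemma tangentB p (v : tangent p) f g :
  smooth_fun_at f p -> smooth_fun_at g p ->
  v (fun q => f q - g q) = v f - v g.
Proof. by move=> sf sg; rewrite tangentD ?tangentN //; exact: smooth_funN. Qed.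

Lemma tangent_sum p (v : tangent p) (I : Type) (s : seq I) (F : I -> M -> R) :
  (forall i, smooth_fun_at (F i) p) ->
  v (fun q => \sum_(i <- s) F i q) = \sum_(i <- s) v (F i).
Proof.
move=> sF; elim: s => [|i s IH].
  by under eq_fun do rewrite big_nil; rewrite big_nil tangent_cst.
under eq_fun do rewrite big_cons; rewrite big_cons tangentD // ?IH //.
exact: smooth_fun_sum.
Qed.

Lemma tangent_comp_chart c p (v : tangent p) (g : 'rV[R]_m -> R) :
  smooth_chart c -> chart_dom c p -> smooth_at g (c p) ->
  v (g \o c) = \sum_i v (chart_coord c i) * 'D_(delta_mx 0 i) g (c p).
Proof.
move=> sc cp sg; rewrite (tangent_chartE v sc cp); last exact: smooth_fun_comp_chart.
apply: eq_bigr => i _; congr (_ * _); apply/esym.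
by apply: near_eq_derive; exact: chart_comp_near.
Qed.

End TangentVectors.

Section VectorFieldLemmas.
Context {R : realType} {m : nat} {M : manifold R m}.
Implicit Types (c a : chart R m M) (p q : M) (f g : M -> R) (X Y : vfield M).

Lemma smooth_vfield_chart c X p : smooth_chart c -> chart_dom c p ->
  (forall i, smooth_fun_at (fun q => X q (chart_coord c i)) p) ->
  smooth_vfield_at X p.
Proof.
move=> sc cp sX f sf.
apply: (@smooth_fun_congr _ _ _ (fun q => \sum_i X q (chart_coord c i)
    * ('D_(delta_mx 0 i) (f \o chart_inv c) \o c) q)); last first.
  by apply: smooth_fun_sum => i; apply: smooth_funM => //; exact: smooth_partial.
apply: filterS2 (near_chart_dom cp) (smooth_fun_near sf) => q cq sfq.
by rewrite (tangent_chartE (X q) sc cq sfq).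
Qed.

Lemma smooth_vfield_coord c X p i : smooth_chart c -> chart_dom c p ->
  smooth_vfield_at X p -> smooth_fun_at (fun q => X q (chart_coord c i)) p.
Proof. by move=> sc cp; apply; exact: smooth_chart_coord. Qed.

Lemma smooth_vfield_congr X Y p : {near p, forall q, X q = Y q} ->
  smooth_vfield_at X p -> smooth_vfield_at Y p.
Proof.
move=> XY sX f sf; apply: smooth_fun_congr (sX f sf).
by apply: filterS XY => q ->.
Qed.

Lemma smooth_vfield0 p : smooth_vfield_at (fun q => 0 : tangent q) p.
Proof. by move=> f _; exact: smooth_fun_cst. Qed.

Lemma smooth_vfieldD X Y p : smooth_vfield_at X p -> smooth_vfield_at Y p ->
  smooth_vfield_at (fun q => X q + Y q) p.
Proof. by move=> sX sY f sf; apply: smooth_funD; [exact: sX|exact: sY]. Qed.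

Lemma smooth_vfieldM (h : M -> R) X p : smooth_fun_at h p ->
  smooth_vfield_at X p -> smooth_vfield_at (fun q => h q *: X q) p.
Proof. by move=> sh sX f sf; apply: smooth_funM => //; exact: sX. Qed.

Lemma smooth_vfield_sum (I : Type) (s : seq I) (F : I -> vfield M) p :
  (forall i, smooth_vfield_at (F i) p) ->
  smooth_vfield_at (fun q => \sum_(i <- s) F i q) p.
Proof.
move=> sF f sf; under eq_fun do rewrite tangent_val_sum.
by apply: smooth_fun_sum => i; exact: sF.
Qed.

Lemma smooth_chart_tangent c p w : smooth_chart c -> chart_dom c p ->
  smooth_vfield_at (fun q => chart_tangent c q w) p.
Proof.
move=> sc cp; apply: (smooth_vfield_chart sc cp) => i.
apply: (@smooth_fun_congr _ _ _ (fun=> w 0 i)); last exact: smooth_fun_cst.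
by apply: filterS (near_chart_dom cp) => q cq; rewrite chart_tangent_coord.
Qed.

(** In a chart the second order terms of X (Y f) and Y (X f) agree, by symmetry
    of second derivatives; the rest is the derivative of f in one direction, so
    the commutator is a tangent vector. *)
Lemma lie_bracketE X Y p f : smooth_vfield_at X p -> smooth_vfield_at Y p ->
  smooth_fun_at f p ->
  lie_bracket X Y p f = X p (fun q => Y q f) - Y p (fun q => X q f).
Proof.
have [c ac cp] := atlas_cover p; have sc := atlas_smooth_chart ac.
move=> sX sY sf0; pose x i := chart_coord c i.
pose w := \row_i (X p (fun q => Y q (x i)) - Y p (fun q => X q (x i))).
apply: (tangent_ofE (c := c) (w := w)) => // {sf0} {}f sf.
set F := f \o chart_inv c.
have sF : smooth_at F (c p) by apply/(smooth_fun_chart _ sc cp).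
pose d i : 'rV[R]_m := delta_mx 0 i.
have second (u : tangent p) Z : smooth_vfield_at Z p ->
    u (fun q => Z q f) = \sum_i u (fun q => Z q (x i)) * 'D_(d i) F (c p)
      + \sum_i \sum_j Z p (x i) * u (x j) * 'D_(d j) ('D_(d i) F) (c p).
  move=> sZ; rewrite (@tangent_congr _ _ _ _ _ _
    (fun q => \sum_i Z q (x i) * ('D_(d i) F \o c) q)); last first.
    apply: filterS2 (near_chart_dom cp) (smooth_fun_near sf) => q cq sfq.
    by rewrite /= (tangent_chartE (Z q) sc cq sfq).
  rewrite tangent_sum; last first.
    move=> i; apply: smooth_funM; first exact: smooth_vfield_coord.
    exact: smooth_partial.
  rewrite -big_split; apply: eq_bigr => i _ /=.
  rewrite tangentM; last exact: smooth_partial; last exact: smooth_vfield_coord.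
  rewrite (tangent_comp_chart (g := 'D_(d i) F) u sc cp); last exact: smooth_at_derive.
  rewrite [LHS]addrC [X in X + _ = _]mulrC; congr (_ + _).
  by rewrite mulr_sumr; apply: eq_bigr => j _; rewrite mulrA.
rewrite !second // deriveE; last exact: smooth_at_differentiable.
rewrite [X in 'd _ _ X](row_sum_delta w) linear_sum.
have dF i : 'd F (c p) (w 0 i *: delta_mx 0 i) = w 0 i * 'D_(d i) F (c p).
  by rewrite linearZ deriveE //; exact: smooth_at_differentiable.
rewrite (eq_bigr _ (fun i _ => dF i)).
have -> : \sum_i \sum_j X p (x i) * Y p (x j) * 'D_(d j) ('D_(d i) F) (c p)
   = \sum_i \sum_j Y p (x i) * X p (x j) * 'D_(d j) ('D_(d i) F) (c p).
  rewrite exchange_big; apply: eq_bigr => i _; apply: eq_bigr => j _.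
  have [A [oA Ap CA]] := sF.
  by rewrite (derive_comm (d j) (d i) oA Ap (CA 2%N)) [_ * Y p _]mulrC.
rewrite opprD addrACA subrr addr0 -sumrB; apply: eq_bigr => i _.
by rewrite mxE -mulrBl.
Qed.

Lemma lie_bracketC X Y p : smooth_vfield_at X p -> smooth_vfield_at Y p ->
  lie_bracket X Y p = - lie_bracket Y X p.
Proof.
move=> sX sY; apply/val_inj/funext => f /=.
have [sf|nsf] := pselect (smooth_fun_at f p); last first.
  by rewrite [RHS]tangent_valN !tangent_nonsmooth ?oppr0.
by rewrite [RHS]tangent_valN !lie_bracketE // opprB.
Qed.

Lemma lie_bracket0 X p : smooth_vfield_at X p ->
  lie_bracket X (fun q => 0 : tangent q) p = 0.
Proof.
move=> sX; apply/val_inj/funext => f /=.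
have [sf|nsf] := pselect (smooth_fun_at f p); last by rewrite !tangent_nonsmooth.
rewrite lie_bracketE //; last exact: smooth_vfield0.
by rewrite tangent_cst tangent_val0 subr0.
Qed.

End VectorFieldLemmas.

(** * Complex functions and the Cauchy-Riemann equations *)

Section ComplexNumbers.
Context {R : realType}.
Implicit Types x y : R[i].

Lemma complexification_scaleE (V : lmodType R) x (z : complexification V) :
  x *: z = (complex.Re x *: z.1 - complex.Im x *: z.2,
            complex.Re x *: z.2 + complex.Im x *: z.1).
Proof. by []. Qed.

Lemma ReD x y : complex.Re (x + y) = complex.Re x + complex.Re y.
Proof. by case: x y => [a b] [c d]. Qed.

Lemma ImD x y : complex.Im (x + y) = complex.Im x + complex.Im y.
Proof. by case: x y => [a b] [c d]. Qed.

Lemma ReM x y :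
  complex.Re (x * y) = complex.Re x * complex.Re y - complex.Im x * complex.Im y.
Proof. by case: x y => [a b] [c d]. Qed.

Lemma ImM x y :
  complex.Im (x * y) = complex.Re x * complex.Im y + complex.Im x * complex.Re y.
Proof. by case: x y => [a b] [c d]. Qed.

Lemma complex_ext x y :
  complex.Re x = complex.Re y -> complex.Im x = complex.Im y -> x = y.
Proof. by case: x y => [a b] [c d] /= -> ->. Qed.

Lemma mulii : ('i * 'i : R[i])%C = -1.
Proof. by rewrite -expr2 sqr_i. Qed.

Lemma i_neq0 : ('i%C : R[i]) != 0.
Proof. by rewrite eq_complex /= oner_eq0 andbF. Qed.

Lemma norm2_neq0 x : x != 0 -> complex.Re x ^+ 2 + complex.Im x ^+ 2 != 0.
Proof.
case: x => a b; rewrite eq_complex /= => ab.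
by rewrite paddr_eq0 ?sqr_ge0 // !expf_eq0.
Qed.

End ComplexNumbers.

Section ComplexFunctions.
Context {R : realType} {m : nat} {M : manifold R m}.
Implicit Types (p q : M) (f g : M -> R[i]).

Lemma csmooth_congr f g p :
  {near p, f =1 g} -> csmooth_fun_at f p -> csmooth_fun_at g p.
Proof.
move=> fg [s1 s2]; split; [apply: smooth_fun_congr s1|apply: smooth_fun_congr s2];
  by apply: filterS fg => q /= ->.
Qed.

Lemma csmooth_near f p : csmooth_fun_at f p -> \forall q \near p, csmooth_fun_at f q.
Proof.
by move=> [s1 s2]; apply: filterS2 (smooth_fun_near s1) (smooth_fun_near s2).
Qed.

Lemma csmooth_cst (k : R[i]) p : csmooth_fun_at (fun=> k) p.
Proof. by split; exact: smooth_fun_cst. Qed.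

Lemma csmoothD f g p : csmooth_fun_at f p -> csmooth_fun_at g p ->
  csmooth_fun_at (fun q => f q + g q) p.
Proof.
move=> [f1 f2] [g1 g2]; split.
  by under eq_fun do rewrite ReD; exact: smooth_funD.
by under eq_fun do rewrite ImD; exact: smooth_funD.
Qed.

Lemma csmoothM f g p : csmooth_fun_at f p -> csmooth_fun_at g p ->
  csmooth_fun_at (fun q => f q * g q) p.
Proof.
move=> [f1 f2] [g1 g2]; split.
  by under eq_fun do rewrite ReM; apply: smooth_funB; exact: smooth_funM.
by under eq_fun do rewrite ImM; apply: smooth_funD; exact: smooth_funM.
Qed.

Lemma csmoothV f p : f p != 0 -> csmooth_fun_at f p ->
  csmooth_fun_at (fun q => (f q)^-1) p.
Proof.
move=> f0 [f1 f2].
have s2 : smooth_fun_at (fun q => (complex.Re (f q) * complex.Re (f q)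
    + complex.Im (f q) * complex.Im (f q))^-1) p.
  apply: smooth_funV; first exact: norm2_neq0.
  by apply: smooth_funD; exact: smooth_funM.
split; [apply: smooth_fun_congr (smooth_funM f1 s2)|
  apply: smooth_fun_congr (smooth_funN (smooth_funM f2 s2))];
  by apply: filterE => q /=; case: (f q).
Qed.

Lemma csmooth_neq0_near f p : f p != 0 -> csmooth_fun_at f p ->
  \forall q \near p, f q != 0.
Proof.
move=> f0 [s1 s2]; have [a aa ap] := atlas_cover p.
pose N q := complex.Re (f q) * complex.Re (f q) + complex.Im (f q) * complex.Im (f q).
have sN : smooth_fun_at N p by apply: smooth_funD; exact: smooth_funM.
have cN := smooth_at_cont (sN a aa ap).
have N0 : (N \o chart_inv a) (a p) != 0 by rewrite /= chart_mapK //; exact: norm2_neq0.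
have nN : \forall x \near a p, (N \o chart_inv a) x != 0 by exact: cvgr_neq0 cN N0.
have := near_chart_map ap nN.
apply: filterS2 (near_chart_dom ap) => q aq /=; rewrite chart_mapK // /N.
by apply: contra_neq => ->; rewrite /= mulr0 addr0.
Qed.

Lemma csmooth_sum (I : Type) (s : seq I) (F : I -> M -> R[i]) p :
  (forall i, csmooth_fun_at (F i) p) ->
  csmooth_fun_at (fun q => \sum_(i <- s) F i q) p.
Proof.
move=> sF; elim: s => [|i s IH].
  by under eq_fun do rewrite big_nil; exact: csmooth_cst.
by under eq_fun do rewrite big_cons; exact: csmoothD.
Qed.

(** The complex differential on real tangent vectors; capply is its complex
    linear extension. *)
Definition cderiv p (v : tangent p) f : R[i] :=
  (v (fun q => complex.Re (f q)) +i* v (fun q => complex.Im (f q)))%C.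

Lemma capplyE p (z : ctangent p) f :
  capply z f = cderiv z.1 f + 'i%C * cderiv z.2 f.
Proof.
by apply: complex_ext; rewrite ?ReD ?ImD ?ReM ?ImM /= ?mul0r ?mul1r ?sub0r ?add0r.
Qed.

Lemma cderiv_congr p (v : tangent p) f g : {near p, f =1 g} -> cderiv v f = cderiv v g.
Proof.
by move=> fg; apply: complex_ext => /=; apply: tangent_congr;
  apply: filterS fg => q /= ->.
Qed.

Lemma cderiv_cst p (v : tangent p) (k : R[i]) : cderiv v (fun=> k) = 0.
Proof. by apply: complex_ext => /=; rewrite tangent_cst. Qed.

Lemma cderivD p (v : tangent p) f g : csmooth_fun_at f p -> csmooth_fun_at g p ->
  cderiv v (fun q => f q + g q) = cderiv v f + cderiv v g.
Proof.
move=> [f1 f2] [g1 g2]; apply: complex_ext; rewrite ?ReD ?ImD /= -tangentD //.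
  by apply: tangent_congr; apply: filterE => q; rewrite ReD.
by apply: tangent_congr; apply: filterE => q; rewrite ImD.
Qed.

Lemma cderivM p (v : tangent p) f g : csmooth_fun_at f p -> csmooth_fun_at g p ->
  cderiv v (fun q => f q * g q) = f p * cderiv v g + g p * cderiv v f.
Proof.
move=> [f1 f2] [g1 g2].
apply: complex_ext; rewrite ?ReD ?ImD ?ReM ?ImM /=.
  under eq_fun do rewrite ReM.
  rewrite tangentB; [|exact: smooth_funM|exact: smooth_funM].
  by rewrite !tangentM //; ring.
under eq_fun do rewrite ImM.
rewrite tangentD; [|exact: smooth_funM|exact: smooth_funM].
by rewrite !tangentM //; ring.
Qed.

Lemma cderivZ p (v : tangent p) (k : R[i]) f : csmooth_fun_at f p ->
  cderiv v (fun q => k * f q) = k * cderiv v f.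
Proof.
move=> sf; rewrite cderivM //; last exact: csmooth_cst.
by rewrite cderiv_cst mulr0 addr0.
Qed.

Lemma cderiv_sum p (v : tangent p) (I : Type) (s : seq I) (F : I -> M -> R[i]) :
  (forall i, csmooth_fun_at (F i) p) ->
  cderiv v (fun q => \sum_(i <- s) F i q) = \sum_(i <- s) cderiv v (F i).
Proof.
move=> sF; elim: s => [|i s IH].
  by under eq_fun do rewrite big_nil; rewrite big_nil cderiv_cst.
under eq_fun do rewrite big_cons; rewrite big_cons cderivD // ?IH //.
exact: csmooth_sum.
Qed.

(** Derive the constant function f / f. *)
Lemma cderivV p (v : tangent p) f : f p != 0 -> csmooth_fun_at f p ->
  cderiv v (fun q => (f q)^-1) = - (f p ^- 2 * cderiv v f).
Proof.
move=> f0 sf; have sV := csmoothV f0 sf.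
have nf0 := csmooth_neq0_near f0 sf.
have : cderiv v (fun q => f q * (f q)^-1) = 0.
  rewrite -(cderiv_cst v 1); apply: cderiv_congr.
  by apply: filterS nf0 => q fq; rewrite divff.
rewrite cderivM // => /eqP; rewrite addr_eq0 => /eqP E.
apply: (mulfI f0); rewrite E mulrN mulrA; congr (- (_ * _)).
by rewrite expr2 invfM mulrA divff // mul1r.
Qed.

Lemma cderivDl p (u v : tangent p) f : cderiv (u + v) f = cderiv u f + cderiv v f.
Proof. by apply: complex_ext; rewrite ?ReD ?ImD. Qed.

Lemma cderivNl p (u : tangent p) f : cderiv (- u) f = - cderiv u f.
Proof. by apply: complex_ext. Qed.

Lemma cderivBl p (u v : tangent p) f : cderiv (u - v) f = cderiv u f - cderiv v f.
Proof. by rewrite cderivDl cderivNl. Qed.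

Lemma cderivZl p (k : R) (u : tangent p) f : cderiv (k *: u) f = k%:C%C * cderiv u f.
Proof.
by apply: complex_ext; rewrite ?ReM ?ImM /= mul0r ?subr0 ?addr0.
Qed.

Lemma cderiv0l p f : cderiv (0 : tangent p) f = 0.
Proof. by []. Qed.

Lemma cderiv_suml p (I : Type) (s : seq I) (F : I -> tangent p) f :
  cderiv (\sum_(i <- s) F i) f = \sum_(i <- s) cderiv (F i) f.
Proof.
by elim: s => [|i s IH]; rewrite ?big_nil // !big_cons cderivDl IH.
Qed.

Lemma csmooth_cderiv (X : vfield M) f p : smooth_vfield_at X p ->
  csmooth_fun_at f p -> csmooth_fun_at (fun q => cderiv (X q) f) p.
Proof. by move=> sX [f1 f2]; split; exact: sX. Qed.

Lemma cderiv_lie_bracket (X Y : vfield M) f p :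
  smooth_vfield_at X p -> smooth_vfield_at Y p -> csmooth_fun_at f p ->
  cderiv (lie_bracket X Y p) f =
  cderiv (X p) (fun q => cderiv (Y q) f) - cderiv (Y p) (fun q => cderiv (X q) f).
Proof.
move=> sX sY [f1 f2]; apply: complex_ext; rewrite ?ReD ?ImD /=;
  by rewrite lie_bracketE.
Qed.

End ComplexFunctions.

(** By Cramer's rule the entries of an inverse matrix belong to any class of
    functions which is closed under ring operations and inverses. This is
    applied to smooth and to holomorphic functions near a point. *)
Section FunctionMatrices.
Context {R : realType} {m : nat} {M : manifold R m}.
Variables (p : M) (P : (M -> R[i]) -> Prop).
Hypothesis Pcst : forall k : R[i], P (fun=> k).
Hypothesis PD : forall f g, P f -> P g -> P (fun q => f q + g q).
Hypothesis PM : forall f g, P f -> P g -> P (fun q => f q * g q).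
Hypothesis PV : forall f, f p != 0 -> P f -> P (fun q => (f q)^-1).

Let Psum (I : Type) (s : seq I) (F : I -> M -> R[i]) :
  (forall i, P (F i)) -> P (fun q => \sum_(i <- s) F i q).
Proof.
move=> sF; elim: s => [|i s IH].
  by under eq_fun do rewrite big_nil; exact: Pcst.
by under eq_fun do rewrite big_cons; exact: PD.
Qed.

Let Pprod (I : Type) (s : seq I) (F : I -> M -> R[i]) :
  (forall i, P (F i)) -> P (fun q => \prod_(i <- s) F i q).
Proof.
move=> sF; elim: s => [|i s IH].
  by under eq_fun do rewrite big_nil; exact: Pcst.
by under eq_fun do rewrite big_cons; exact: PM.
Qed.

Lemma det_closed n (A : M -> 'M[R[i]]_n) :
  (forall i j, P (fun q => A q i j)) -> P (fun q => \det (A q)).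
Proof.
move=> PA; rewrite /determinant; apply: Psum => s; apply: PM; first exact: Pcst.
by apply: Pprod => i.
Qed.

Lemma adj_closed n (A : M -> 'M[R[i]]_n) i j :
  (forall i j, P (fun q => A q i j)) -> P (fun q => (\adj (A q)) i j).
Proof.
move=> PA; under eq_fun do rewrite mxE.
rewrite /cofactor; apply: PM; first exact: Pcst.
by apply: det_closed => k l; under eq_fun do rewrite !mxE.
Qed.

Lemma inv_mx_closed n (A : M -> 'M[R[i]]_n) i j :
  (forall i j, P (fun q => A q i j)) -> A p \in unitmx ->
  P (fun q => (\det (A q))^-1 * (\adj (A q)) i j).
Proof.
move=> PA uA; apply: PM; last exact: adj_closed.
by apply: PV; [rewrite -unitfE -unitmxE|exact: det_closed].
Qed.

End FunctionMatrices.

Lemma unitmx_of_ker (F : fieldType) n (A : 'M[F]_n) :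
  (forall c : 'rV[F]_n, c *m A = 0 -> c = 0) -> A \in unitmx.
Proof.
move=> kA; rewrite -row_free_unit -kermx_eq0; apply/eqP/row_matrixP => i.
by rewrite row0; apply: kA; rewrite -row_mul mulmx_ker row0.
Qed.

Section AlmostComplex.
Context {R : realType} {m : nat} {M : manifold R m} (J : almost_complex M).
Implicit Types (p q : M) (f g : M -> R[i]).

Lemma type01P p (z : ctangent p) : type01 J z <-> z.2 = J p z.1.
Proof.
case: z => u v; rewrite /type01 /Jc /=; split.
    by move=> [-> _]; rewrite /= oppr0 scale0r sub0r scaleN1r opprK.
move=> ->; rewrite acs_sqr complexification_scaleE /=.
by rewrite oppr0 !scale0r sub0r !add0r !scaleN1r opprK.
Qed.

Lemma type10P p (z : ctangent p) : type10 J z <-> z.2 = - J p z.1.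
Proof.
case: z => u v; rewrite /type10 /Jc /=; split.
  by move=> [-> _]; rewrite /= scale0r sub0r scale1r opprK.
move=> ->; rewrite linearN acs_sqr complexification_scaleE /=.
by rewrite !scale0r sub0r !add0r !scale1r !opprK.
Qed.

Definition cmul p (c : R[i]) (u : tangent p) : tangent p :=
  complex.Re c *: u + complex.Im c *: J p u.

Lemma cauchy_riemannE f p :
  cauchy_riemann J f p <->
  forall v : tangent p, cderiv (J p v) f = 'i%C * cderiv v f.
Proof.
by split=> CR v; have := CR v; rewrite !capplyE /= !cderiv0l mulr0 !addr0.
Qed.

Lemma cderiv_cmul p c (u : tangent p) f :
  cderiv (J p u) f = 'i%C * cderiv u f -> cderiv (cmul c u) f = c * cderiv u f.
Proof.
move=> CR; rewrite /cmul cderivDl !cderivZl CR mulrA -mulrDl.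
by rewrite [X in (_ + X) * _]mulrC -complexE.
Qed.

Lemma J_cmul p c (u : tangent p) : J p (cmul c u) = cmul ('i%C * c) u.
Proof.
rewrite /cmul linearD !linearZ /= acs_sqr ReM ImM /= !mul0r !mul1r !add0r.
by rewrite scalerN scaleNr addrC.
Qed.

Lemma cr_cst (k : R[i]) p : cauchy_riemann J (fun=> k) p.
Proof. by apply/cauchy_riemannE => v; rewrite !cderiv_cst mulr0. Qed.

Lemma crD f g p : csmooth_fun_at f p -> csmooth_fun_at g p ->
  cauchy_riemann J f p -> cauchy_riemann J g p ->
  cauchy_riemann J (fun q => f q + g q) p.
Proof.
move=> sf sg /cauchy_riemannE CRf /cauchy_riemannE CRg; apply/cauchy_riemannE => v.
by rewrite !cderivD // CRf CRg mulrDr.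
Qed.

Lemma crM f g p : csmooth_fun_at f p -> csmooth_fun_at g p ->
  cauchy_riemann J f p -> cauchy_riemann J g p ->
  cauchy_riemann J (fun q => f q * g q) p.
Proof.
move=> sf sg /cauchy_riemannE CRf /cauchy_riemannE CRg; apply/cauchy_riemannE => v.
by rewrite !cderivM // CRf CRg; ring.
Qed.

Lemma crV f p : f p != 0 -> csmooth_fun_at f p -> cauchy_riemann J f p ->
  cauchy_riemann J (fun q => (f q)^-1) p.
Proof.
move=> f0 sf /cauchy_riemannE CRf; apply/cauchy_riemannE => v.
by rewrite !cderivV // CRf; ring.
Qed.

Lemma hol_cst (k : R[i]) p : holomorphic_fun_at J (fun=> k) p.
Proof. by split; [exact: csmooth_cst|apply: filterE => q; exact: cr_cst]. Qed.

Lemma holD f g p : holomorphic_fun_at J f p -> holomorphic_fun_at J g p ->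
  holomorphic_fun_at J (fun q => f q + g q) p.
Proof.
move=> [sf hf] [sg hg]; split; first exact: csmoothD.
near=> q; apply: crD; near: q => //; exact: csmooth_near.
Unshelve. all: by end_near. Qed.

Lemma holM f g p : holomorphic_fun_at J f p -> holomorphic_fun_at J g p ->
  holomorphic_fun_at J (fun q => f q * g q) p.
Proof.
move=> [sf hf] [sg hg]; split; first exact: csmoothM.
near=> q; apply: crM; near: q => //; exact: csmooth_near.
Unshelve. all: by end_near. Qed.

Lemma holV f p : f p != 0 -> holomorphic_fun_at J f p ->
  holomorphic_fun_at J (fun q => (f q)^-1) p.
Proof.
move=> f0 [sf hf]; split; first exact: csmoothV.
near=> q; apply: crV; near: q => //; [exact: csmooth_neq0_near|exact: csmooth_near].
Unshelve. all: by end_near. Qed.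

Lemma hol_congr f g p : {near p, f =1 g} -> holomorphic_fun_at J f p ->
  holomorphic_fun_at J g p.
Proof.
move=> fg [sf hf]; split; first exact: csmooth_congr sf.
have := near_join fg.
apply: filterS2 hf => q /cauchy_riemannE CR fgq; apply/cauchy_riemannE => v.
by rewrite -!(cderiv_congr _ fgq).
Qed.

End AlmostComplex.

(** * Holomorphic coordinates *)

Section HolomorphicCoordinateLemmas.
Context {R : realType} {n : nat} {M : manifold R (n + n)} (J : almost_complex M).
Implicit Types (c : chart R (n + n) M) (p q : M) (f g : M -> R[i]).

Lemma csmooth_zcoord c p j : smooth_chart c -> chart_dom c p ->
  csmooth_fun_at (zcoord c j) p.
Proof.
move=> sc cp; split; first exact: (smooth_chart_coord (lshift n j) sc cp).
exact: (smooth_chart_coord (rshift n j) sc cp).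
Qed.

Lemma cderiv_zcoord_inj c p (u v : tangent p) : smooth_chart c -> chart_dom c p ->
  (forall j, cderiv u (zcoord c j) = cderiv v (zcoord c j)) -> u = v.
Proof.
move=> sc cp uv; apply: (tangent_eqP sc cp) => i.
by case: (split_ordP i) => j ->; case: (uv j).
Qed.

(** Holomorphic coordinates identify the real tangent space with C^n, by sending
    u to its derivatives of z_1, ..., z_n; this is the inverse map. *)
Definition ztangent c p (a : 'I_n -> R[i]) : tangent p :=
  chart_tangent c p (row_mx (\row_j complex.Re (a j)) (\row_j complex.Im (a j))).

Lemma ztangentE c p a j : smooth_chart c -> chart_dom c p ->
  cderiv (ztangent c p a) (zcoord c j) = a j.
Proof.
move=> sc cp; apply: complex_ext => /=.
  rewrite -[LHS]/(ztangent c p a (chart_coord c (lshift n j))).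
  by rewrite chart_tangent_coord // row_mxEl mxE.
rewrite -[LHS]/(ztangent c p a (chart_coord c (rshift n j))).
by rewrite chart_tangent_coord // row_mxEr mxE.
Qed.

Lemma smooth_ztangent c p (a : 'I_n -> M -> R[i]) : smooth_chart c -> chart_dom c p ->
  (forall j, csmooth_fun_at (a j) p) ->
  smooth_vfield_at (fun q => ztangent c q (fun j => a j q)) p.
Proof.
move=> sc cp sa; apply: (smooth_vfield_chart sc cp) => i.
case: (split_ordP i) => j ->; have [s1 s2] := sa j.
  apply: smooth_fun_congr s1; apply: filterS (near_chart_dom cp) => q cq.
  by rewrite chart_tangent_coord // row_mxEl mxE.
apply: smooth_fun_congr s2; apply: filterS (near_chart_dom cp) => q cq.
by rewrite chart_tangent_coord // row_mxEr mxE.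
Qed.

Lemma capplyD p (z w : ctangent p) f : capply (z + w) f = capply z f + capply w f.
Proof.
by rewrite !capplyE /= !cderivDl mulrDr addrACA.
Qed.

Lemma capplyZ p (k : R[i]) (z : ctangent p) f : capply (k *: z) f = k * capply z f.
Proof.
rewrite !capplyE /= cderivBl cderivDl !cderivZl [in RHS](complexE k).
have E (x : R[i]) : - x = 'i%C * ('i%C * x) by rewrite mulrA mulii mulN1r.
by rewrite [X in _ + X + _]E; ring.
Qed.

Lemma ctangent_sum1 p (I : Type) (s : seq I) (F : I -> ctangent p) :
  (\sum_(i <- s) F i).1 = \sum_(i <- s) (F i).1.
Proof. by elim: s => [|i s IH]; rewrite ?big_nil // !big_cons /= IH. Qed.

Lemma capply_sum p (I : Type) (s : seq I) (F : I -> ctangent p) f :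
  capply (\sum_(i <- s) F i) f = \sum_(i <- s) capply (F i) f.
Proof.
elim: s => [|i s IH]; rewrite ?big_nil ?big_cons ?capplyD ?IH //.
by rewrite capplyE /= !cderiv0l mulr0 addr0.
Qed.

Lemma capply_real p (u : tangent p) f : capply ((u, 0) : ctangent p) f = cderiv u f.
Proof. by rewrite capplyE /= cderiv0l mulr0 addr0. Qed.

Lemma zcoord_CR c p j : holomorphic_chart J c -> chart_dom c p ->
  forall v, cderiv (J p v) (zcoord c j) = 'i%C * cderiv v (zcoord c j).
Proof. by move=> [_ CR] cp; exact/cauchy_riemannE/CR. Qed.

(** The differentials of the z_j are of type (1,0) and their real and imaginary
    parts are coordinates on the tangent space. *)
Lemma type01_zcoord c p (z : ctangent p) : holomorphic_chart J c -> chart_dom c p ->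
  type01 J z <-> forall j, capply z (zcoord c j) = 0.
Proof.
move=> hc cp; rewrite type01P; split=> [zJ j|z0].
  by rewrite capplyE zJ (zcoord_CR _ hc cp) mulrA mulii mulN1r subrr.
apply: (cderiv_zcoord_inj hc.1 cp) => j; rewrite (zcoord_CR _ hc cp).
have := z0 j; rewrite capplyE addrC => /eqP; rewrite addr_eq0 => /eqP E.
by apply: (mulfI (@i_neq0 R)); rewrite E mulrA mulii mulN1r.
Qed.

Lemma type10_01 p (z : ctangent p) : type10 J z -> type01 J z -> z = 0.
Proof.
case: z => u v; rewrite type10P type01P /= => -> /eqP.
rewrite eq_sym -addr_eq0 -mulr2n -scaler_nat scaler_eq0 pnatr_eq0 /= => /eqP Ju0.
have u0 : u = 0 by rewrite -[u]opprK -(acs_sqr J u) Ju0 linear0 oppr0.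
by rewrite Ju0 u0 oppr0.
Qed.

Lemma cderiv_frame c p (X : 'I_n -> tangent p) (a : 'I_n -> R[i]) j :
  holomorphic_chart J c -> chart_dom c p ->
  cderiv (\sum_k cmul J (a k) (X k)) (zcoord c j)
  = \sum_k a k * cderiv (X k) (zcoord c j).
Proof.
move=> hc cp; rewrite cderiv_suml; apply: eq_bigr => k _.
by rewrite cderiv_cmul //; exact: (zcoord_CR _ hc cp).
Qed.

Definition real_frame p (X : 'I_n -> tangent p) (k : 'I_n + 'I_n) : tangent p :=
  match k with inl k => X k | inr k => J p (X k) end.

(** Since dz_j turns J into multiplication by i, a complex relation between the
    rows is a real relation between the vectors X k and J (X k). *)
Lemma frame_unitmx c p (X : 'I_n -> tangent p) :
  holomorphic_chart J c -> chart_dom c p -> lin_indep (real_frame X) ->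
  \matrix_(k, j) cderiv (X k) (zcoord c j) \in unitmx.
Proof.
move=> hc cp iX; apply: unitmx_of_ker => a aA.
have S0 : \sum_k cmul J (a 0 k) (X k) = 0.
  apply: (cderiv_zcoord_inj hc.1 cp) => j; rewrite cderiv_frame // cderiv0l.
  have /rowP /(_ j) := aA; rewrite !mxE => aAj; rewrite -[RHS]aAj.
  by apply: eq_bigr => k _; rewrite mxE.
pose r k := match k with inl k => complex.Re (a 0 k) | inr k => complex.Im (a 0 k) end.
have r0 : forall k, r k = 0.
  apply: iX; rewrite big_sumType /= -[RHS]S0 -big_split /=.
  by apply: eq_bigr.
by apply/rowP => k; rewrite mxE; apply: complex_ext;
  [exact: (r0 (inl k))|exact: (r0 (inr k))].
Qed.

Lemma frame_span c p (X : 'I_n -> tangent p) (v : tangent p) :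
  holomorphic_chart J c -> chart_dom c p -> lin_indep (real_frame X) ->
  exists a : 'I_n -> R[i], v = \sum_k cmul J (a k) (X k).
Proof.
move=> hc cp iX; have uA := frame_unitmx hc cp iX.
set A := \matrix_(_, _) _ in uA.
pose w := (\row_j cderiv v (zcoord c j)) *m invmx A.
exists (fun k => w 0 k); apply: (cderiv_zcoord_inj hc.1 cp) => j.
rewrite cderiv_frame //; have : (w *m A) 0 j = cderiv v (zcoord c j) by rewrite mulmxKV // mxE.
by rewrite mxE => <-; apply: eq_bigr => k _; rewrite [A k j]mxE.
Qed.

(** * From bracket identities to holomorphic vector fields *)

Section FrameToHolomorphic.
Variable X : 'I_n -> vfield M.
Hypothesis sX : forall k, smooth_vfield (X k).
Hypothesis iX : forall p, lin_indep (real_frame (fun k => X k p)).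
Hypothesis bracket_JJ : forall k l : 'I_n, (k < l)%N -> forall p : M,
  lie_bracket (X k) (X l) p = - lie_bracket (Jfield J (X k)) (Jfield J (X l)) p.
Hypothesis bracket_J : forall k l : 'I_n, (k <= l)%N -> forall p : M,
  lie_bracket (Jfield J (X k)) (X l) p = J p (lie_bracket (X k) (X l) p).

Let sJX k p : smooth_vfield_at (Jfield J (X k)) p.
Proof. exact/acs_smooth/sX. Qed.

(** Apply the bracket identities to z_j: as dz_j turns J into multiplication by
    i, the second one gives the equation for k <= l. For l < k it is the first
    one, in which the terms along X l cancel by the previous case. *)
Lemma frame_component_CR c p k l j : holomorphic_chart J c -> chart_dom c p ->
  cderiv (J p (X k p)) (fun q => cderiv (X l q) (zcoord c j)) =
  'i%C * cderiv (X k p) (fun q => cderiv (X l q) (zcoord c j)).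
Proof.
move=> hc cp; have sz := csmooth_zcoord j hc.1 cp.
pose a k q := cderiv (X k q) (zcoord c j).
have sa k' : csmooth_fun_at (a k') p by apply: csmooth_cderiv => //; exact: sX.
have Ja (v : tangent p) k' : cderiv v (fun q => cderiv (Jfield J (X k') q) (zcoord c j)) =
    'i%C * cderiv v (a k').
  rewrite -cderivZ //; apply: cderiv_congr.
  by apply: filterS (near_chart_dom cp) => q cq; rewrite (zcoord_CR _ hc cq).
have CR0 (k' l' : 'I_n) : (k' <= l')%N ->
    cderiv (J p (X k' p)) (a l') = 'i%C * cderiv (X k' p) (a l').
  move=> kl; have := congr1 (fun v => cderiv v (zcoord c j)) (bracket_J kl p).
  rewrite /= (zcoord_CR _ hc cp) !cderiv_lie_bracket //; try exact: sX.
  by rewrite Ja -/(a k') -/(a l') mulrBr => /addIr.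
have [kl|lk] := leqP k l; first exact: CR0.
have := congr1 (fun v => cderiv v (zcoord c j)) (bracket_JJ lk p).
rewrite /= cderivNl !cderiv_lie_bracket //; try exact: sX.
rewrite !Ja -/(a k) -/(a l) /Jfield CR0 1?ltnW // mulrA mulii mulN1r opprB opprK.
rewrite [RHS]addrC => /addrI /eqP; rewrite eqr_oppLR => /eqP ->.
by rewrite mulrN mulrA mulii mulN1r opprK.
Qed.

(** The Cauchy-Riemann equation along each X k extends to all tangent vectors,
    which are complex combinations of the X k. *)
Lemma frame_component_hol c p l j : holomorphic_chart J c -> chart_dom c p ->
  holomorphic_fun_at J (fun q => cderiv (X l q) (zcoord c j)) p.
Proof.
move=> hc cp; split.
  by apply: csmooth_cderiv; [exact: sX|exact: csmooth_zcoord hc.1 cp].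
apply: filterS (near_chart_dom cp) => q cq; apply/cauchy_riemannE => v.
have [a ->] := frame_span v hc cq (@iX q).
rewrite linear_sum !cderiv_suml mulr_sumr; apply: eq_bigr => k _.
have CR := frame_component_CR k l j hc cq.
by rewrite J_cmul !(cderiv_cmul _ CR) mulrA.
Qed.

Lemma holomorphic_fields_of_frame : exists Z : 'I_n -> cvfield M,
  (forall k, holomorphic_vfield J (Z k)) /\ (forall p, lin_indep (fun k => Z k p)).
Proof.
exists (fun k p => (X k p, - J p (X k p))); split=> [k|p a a0].
  split=> [p|c p hc cp j]; first exact/type10P.
  have := holM (hol_cst J 2 p) (frame_component_hol k j hc cp).
  apply: hol_congr; apply: filterS (near_chart_dom cp) => q cq.
  rewrite capplyE /= cderivNl (zcoord_CR _ hc cq) mulrN mulrA mulii mulN1r opprK.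
  by rewrite mulr2n mulrDl mul1r.
pose r k := match k with inl k => complex.Re (a k) | inr k => complex.Im (a k) end.
have r0 : forall k, r k = 0.
  apply: (iX (p := p)); rewrite big_sumType /= -big_split /=.
  have /(congr1 fst) := a0; rewrite ctangent_sum1 => E; rewrite -[RHS]E.
  by apply: eq_bigr => k _; rewrite /= scalerN opprK.
by move=> k; apply: complex_ext; [exact: (r0 (inl k))|exact: (r0 (inr k))].
Qed.

End FrameToHolomorphic.
End HolomorphicCoordinateLemmas.

(** * The dual coframe of a holomorphic frame *)

Section HolomorphicFieldsToForms.
Context {R : realType} {n : nat} {M : manifold R (n + n)} (J : almost_complex M).
Hypothesis J_integrable : integrable_acs J.
Implicit Types (c : chart R (n + n) M) (p q : M) (f g : M -> R[i]).

Definition hol_chart_at p : chart R (n + n) M := s2val (cid2 (J_integrable p)).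

Lemma hol_chart_atP p : holomorphic_chart J (hol_chart_at p).
Proof. by rewrite /hol_chart_at; case: cid2. Qed.

Lemma hol_chart_at_dom p : chart_dom (hol_chart_at p) p.
Proof. by rewrite /hol_chart_at; case: cid2. Qed.

Lemma type10_comb p (I : Type) (s : seq I) (a : I -> R[i]) (F : I -> ctangent p) :
  (forall i, type10 J (F i)) -> type10 J (\sum_(i <- s) a i *: F i).
Proof.
move=> tF; elim: s => [|i s IH].
  by rewrite big_nil; apply/type10P; rewrite /= linear0 oppr0.
rewrite big_cons; move/type10P: IH => IH; apply/type10P; rewrite /= IH.
move/type10P: (tF i) => ->.
have E (x y : R) (u w : tangent p) :
    x *: - J p u + y *: u - J p w = - J p (x *: u - y *: - J p u + w).
  have -> : J p (x *: u - y *: - J p u + w) = x *: J p u - y *: u + J p w.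
    by rewrite scalerN opprK !linearD !linearZ /= acs_sqr scalerN.
  by rewrite !opprD opprK scalerN.
exact: E.
Qed.

Definition zrow c p (z : ctangent p) : 'rV[R[i]]_n := \row_j capply z (zcoord c j).

Lemma zrow_linear c p (k : R[i]) (z w : ctangent p) :
  zrow c (k *: z + w) = k *: zrow c z + zrow c w.
Proof. by apply/rowP => j; rewrite !mxE capplyD capplyZ. Qed.

Lemma zrow_sum c p (a : 'I_n -> R[i]) (Z : 'I_n -> ctangent p) :
  zrow c (\sum_k a k *: Z k) = (\row_k a k) *m \matrix_k zrow c (Z k).
Proof.
apply/rowP => j; rewrite !mxE capply_sum; apply: eq_bigr => k _.
by rewrite capplyZ !mxE.
Qed.

Variable Z : 'I_n -> cvfield M.
Hypothesis hZ : forall k, holomorphic_vfield J (Z k).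
Hypothesis iZ : forall p, lin_indep (fun k => Z k p).

Definition zmatrix c p : 'M[R[i]]_n := \matrix_k zrow c (Z k p).

Lemma zmatrix_unit c p : holomorphic_chart J c -> chart_dom c p ->
  zmatrix c p \in unitmx.
Proof.
move=> hc cp; apply: unitmx_of_ker => a aA.
have S0 : \sum_k a 0 k *: Z k p = 0.
  apply: (@type10_01 _ _ _ J); first by apply: type10_comb => k; exact: (hZ k).1.
  apply/(type01_zcoord _ hc cp) => j.
  have := zrow_sum c (fun k => a 0 k) (fun k => Z k p).
  rewrite -/(zmatrix c p) (_ : \row_k a 0 k = a); last by apply/rowP => k; rewrite mxE.
  by rewrite aA => /rowP /(_ j); rewrite !mxE.
by apply/rowP => k; rewrite mxE; exact: iZ S0 k.
Qed.

Definition dual_row c p (z : ctangent p) : 'rV[R[i]]_n := zrow c z *m invmx (zmatrix c p).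

(** Determines the components of z on the frame, modulo T^{0,1}, without
    reference to the chart; this makes the dual forms globally well defined
    although each value is computed in a chosen chart. *)
Lemma dual_rowP c p (z : ctangent p) (a : 'rV[R[i]]_n) :
  holomorphic_chart J c -> chart_dom c p ->
  a = dual_row c z <-> type01 J (z - \sum_k a 0 k *: Z k p).
Proof.
move=> hc cp; have uA := zmatrix_unit hc cp.
have E j : capply (z - \sum_k a 0 k *: Z k p) (zcoord c j) = (zrow c z - a *m zmatrix c p) 0 j.
  have := zrow_sum c (fun k => a 0 k) (fun k => Z k p).
  rewrite -/(zmatrix c p) (_ : \row_k a 0 k = a); last by apply/rowP => k; rewrite mxE.
  move=> /rowP /(_ j); rewrite mxE => E.
  rewrite -[X in z + X]scaleN1r capplyD capplyZ E !mxE mulN1r; congr (_ - _).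
split=> [aE|/(type01_zcoord _ hc cp) t01].
  by apply/(type01_zcoord _ hc cp) => j; rewrite E aE mulmxKV // subrr mxE.
rewrite /dual_row; apply: (canRL (mulmxK uA)).
by apply/eqP; rewrite eq_sym -subr_eq0; apply/eqP/rowP => j; rewrite -E t01 mxE.
Qed.

Lemma dual_row_linear k p : linear (fun z : ctangent p =>
  (dual_row (hol_chart_at p) z 0 k : R[i]^o)).
Proof.
move=> a z w; rewrite /dual_row zrow_linear mulmxDl -scalemxAl mxE [in LHS]mxE //.
Qed.

Definition dual_form (k : 'I_n) : cform1 M := fun p =>
  HB.pack (fun z : ctangent p => (dual_row (hol_chart_at p) z 0 k : R[i]^o))
    (GRing.isLinear.Build R[i] _ _ _ _ (@dual_row_linear k p)).

Lemma dual_formE c p k (z : ctangent p) : holomorphic_chart J c -> chart_dom c p ->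
  dual_form k p z = dual_row c z 0 k.
Proof.
move=> hc cp; congr (fun_of_matrix _ 0 k); apply/(dual_rowP _ _ hc cp).
exact/(dual_rowP _ _ (hol_chart_atP p) (hol_chart_at_dom p)).
Qed.

(** In a holomorphic chart the coefficients of the dual forms on dz_1, ..., dz_n
    are the entries of the inverse of the matrix of the holomorphic functions
    Z_k(z_j). *)
Lemma dual_form_holomorphic k : holomorphic_form J (dual_form k).
Proof.
split=> [p z t01|c p hc cp].
  rewrite /= /dual_row (_ : zrow _ z = 0) ?mul0mx ?mxE //.
  apply/rowP => j; rewrite !mxE.
  exact: (type01_zcoord _ (hol_chart_atP p) (hol_chart_at_dom p)).1.
have uA := zmatrix_unit hc cp.
have hA i j : holomorphic_fun_at J (fun q => zmatrix c q i j) p.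
  have := (hZ i).2 c p hc cp j; apply: hol_congr.
  by apply: filterE => q; rewrite !mxE.
exists (fun j q => (\det (zmatrix c q))^-1 * (\adj (zmatrix c q)) j k); split.
  move=> j; apply: (inv_mx_closed (p := p) (P := fun f => holomorphic_fun_at J f p)) => //.
  - by move=> ?; exact: hol_cst.
  - by move=> f g; exact: holD.
  - by move=> f g; exact: holM.
  - by move=> f; exact: holV.
apply: filterS (near_chart_dom cp) => q cq z.
rewrite (dual_formE k z hc cq) /dual_row !mxE; apply: eq_bigr => j _.
by rewrite /invmx (zmatrix_unit hc cq) !mxE mulrC.
Qed.

Lemma dual_form_indep p (a : 'I_n -> R[i]) :
  (forall z : ctangent p, \sum_k a k * dual_form k p z = 0) -> forall k, a k = 0.
Proof.
move=> a0 l; set c := hol_chart_at p.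
have D : dual_row c (Z l p) = delta_mx 0 l.
  apply/esym/(dual_rowP _ _ (hol_chart_atP p) (hol_chart_at_dom p)).
  rewrite (bigD1 l) //= big1 => [|k /negPf kl].
    by rewrite mxE !eqxx scale1r addr0 subrr; apply/type01P; rewrite /= linear0.
  by rewrite mxE kl andbF scale0r.
have := a0 (Z l p); rewrite (bigD1 l) //= big1 => [|k /negPf kl].
  by rewrite -/c D mxE !eqxx mulr1 addr0.
by rewrite -/c D mxE kl andbF mulr0.
Qed.

Lemma holomorphic_coframe_of_fields : exists alpha : 'I_n -> cform1 M,
  (forall k, holomorphic_form J (alpha k)) /\
  (forall (p : M) (a : 'I_n -> R[i]),
     (forall z : ctangent p, \sum_k a k * alpha k p z = 0) -> forall k, a k = 0).
Proof. by exists dual_form; split; [exact: dual_form_holomorphic|exact: dual_form_indep]. Qed.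

End HolomorphicFieldsToForms.

Section HolomorphicFormsClosed.
Context {R : realType} {n : nat} {M : manifold R (n + n)} (J : almost_complex M).
Hypothesis J_integrable : integrable_acs J.

Lemma csmooth_capply (Z : cvfield M) f p : csmooth_vfield_at Z p -> csmooth_fun_at f p ->
  csmooth_fun_at (fun q => capply (Z q) f) p.
Proof.
move=> [s1 s2] sf; under eq_fun do rewrite capplyE.
apply: csmoothD; first exact: csmooth_cderiv.
by apply: csmoothM; [exact: csmooth_cst|exact: csmooth_cderiv].
Qed.

Lemma capply_clie_bracket (Z W : cvfield M) f p :
  csmooth_vfield_at Z p -> csmooth_vfield_at W p -> csmooth_fun_at f p ->
  capply (clie_bracket Z W p) f =
  capply (Z p) (fun q => capply (W q) f) - capply (W p) (fun q => capply (Z q) f).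
Proof.
move=> [Z1 Z2] [W1 W2] sf.
have cap (u : tangent p) (V : cvfield M) : csmooth_vfield_at V p ->
    cderiv u (fun q => capply (V q) f) =
    cderiv u (fun q => cderiv (V q).1 f) + 'i%C * cderiv u (fun q => cderiv (V q).2 f).
  move=> [V1 V2]; under [X in cderiv _ X]eq_fun do rewrite capplyE.
  rewrite cderivD ?cderivZ //; try exact: csmooth_cderiv.
  by apply: csmoothM; [exact: csmooth_cst|exact: csmooth_cderiv].
rewrite !capplyE !cap //= cderivBl cderivDl !cderiv_lie_bracket //.
set a := cderiv (Z p).1 _.
have E (x : R[i]) : 'i%C * ('i%C * x) = - x by rewrite mulrA mulii mulN1r.
rewrite !mulrDr !E !mulrN; ring.
Qed.

(** Writing alpha as the sum of the f_j dz_j, d alpha (Z, W) is the sum of the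
    Z(f_j) W(z_j) - W(f_j) Z(z_j), because the bracket absorbs the second
    derivatives of z_j. A vector Z of type (0,1) annihilates the f_j and the
    z_j. *)
Lemma holomorphic_form_d_type20 (alpha : cform1 M) :
  holomorphic_form J alpha -> d_type20 J alpha.
Proof.
move=> [_ alpha_hol] Z W p sZ sW t01.
have [c hc cp] := J_integrable p; have [f [hf alphaE]] := alpha_hol c p hc cp.
have sz j := csmooth_zcoord j hc.1 cp.
have alphaV (u : tangent p) (V : cvfield M) : csmooth_vfield_at V p ->
    cderiv u (fun q => alpha q (V q) : R[i]) =
    \sum_j (f j p * cderiv u (fun q => capply (V q) (zcoord c j))
            + capply (V p) (zcoord c j) * cderiv u (f j)).
  move=> sV; rewrite (@cderiv_congr _ _ _ _ _ _
    (fun q => \sum_j f j q * capply (V q) (zcoord c j))); last first.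
    by apply: filterS alphaE => q; apply.
  have sVz j := csmooth_capply sV (sz j).
  rewrite cderiv_sum; last by move=> j; apply: csmoothM => //; exact: (hf j).1.
  by apply: eq_bigr => j _; rewrite cderivM //; exact: (hf j).1.
have capV (z : ctangent p) (V : cvfield M) : csmooth_vfield_at V p ->
    capply z (fun q => alpha q (V q) : R[i]) =
    \sum_j (f j p * capply z (fun q => capply (V q) (zcoord c j))
            + capply (V p) (zcoord c j) * capply z (f j)).
  move=> sV; rewrite capplyE !alphaV // mulr_sumr -big_split; apply: eq_bigr => j _.
  by rewrite !capplyE /=; ring.
rewrite /cform1_d !capV // (nbhs_singleton alphaE) -!sumrB big1 // => j _.
rewrite capply_clie_bracket //.
have -> : capply (Z p) (f j) = 0.
  have /cauchy_riemannE CR := nbhs_singleton (hf j).2.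
  by move/type01P: t01 => t01; rewrite capplyE t01 CR mulrA mulii mulN1r subrr.
have -> : capply (Z p) (zcoord c j) = 0 by exact: (type01_zcoord _ hc cp).1.
by ring.
Qed.

End HolomorphicFormsClosed.

(** * Fields along curves *)

Section Curves.
Context {R : realType} {m : nat} {M : manifold R m}.
Implicit Types (g : R -> M) (t : R).

Lemma is_derive_curve g t (f : M -> R) : smooth_curve_at g t ->
  smooth_fun_at f (g t) -> is_derive t 1 (f \o g) (velocity g t f).
Proof.
move=> [cg sg] sf; have [a aa ap] := atlas_cover (g t).
have sa := atlas_smooth_chart aa; have sag := sg a aa ap.
have near_a h : {near t, (h \o chart_inv a) \o (a \o g) =1 (h : M -> R) \o g}.
  have : \forall s \near t, chart_dom a (g s) by exact: cg (near_chart_dom ap).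
  by apply: filterS => s as_ /=; rewrite chart_mapK.
pose w := 'D_1 (a \o g) t.
have dag : differentiable (a \o g) t by exact: smooth_at_differentiable.
have key h : smooth_fun_at h (g t) ->
    is_derive t 1 (h \o g) ('D_w (h \o chart_inv a) (a (g t))).
  move=> sh; apply: near_eq_is_derive (near_a h) _.
  have dh : differentiable (h \o chart_inv a) ((a \o g) t).
    exact/smooth_at_differentiable/sh.
  have dc : differentiable ((h \o chart_inv a) \o (a \o g)) t.
    exact: differentiable_comp.
  split; first exact: diff_derivable.
  by rewrite deriveE // diff_comp //= -(deriveE _ dag) -(deriveE _ dh).
have -> : velocity g t f = 'D_w (f \o chart_inv a) (a (g t)).
  rewrite /velocity (@tangent_ofE _ _ _ a _ _ w) //.
    by rewrite derive1E; have [_ ->] := key f sf.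
  by move=> h sh; rewrite derive1E; have [_ ->] := key h sh.
exact: key.
Qed.

(** Derives a real 1-form phi along a field V on a curve, from the expression of
    V by ambient fields that the definition of covariant derivatives provides. *)
Lemma is_derive_along g t (k : nat) (E : 'I_k -> vfield M) (a : 'I_k -> R -> R)
    (V : forall s, tangent (g s)) (phi : forall q : M, tangent q -> R) :
  smooth_curve_at g t ->
  (forall q (u v : tangent q), phi q (u + v) = phi q u + phi q v) ->
  (forall q r (u : tangent q), phi q (r *: u) = r * phi q u) ->
  (forall i, smooth_fun_at (fun q => phi q (E i q)) (g t)) ->
  (forall i, derivable (a i) t 1) ->
  (\forall s \near t, V s = \sum_i a i s *: E i (g s)) ->
  is_derive t 1 (fun s => phi (g s) (V s))
    (\sum_i (derive1 (a i) t * phi (g t) (E i (g t))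
             + a i t * velocity g t (fun q => phi q (E i q)))).
Proof.
move=> sg phiD phiZ sphi da VE.
pose h i s := a i s * phi (g s) (E i (g s)).
have phis q (F : 'I_k -> tangent q) : phi q (\sum_i F i) = \sum_i phi q (F i).
  by apply: (big_morph (phi q) (phiD q)); rewrite -(scale0r 0) phiZ mul0r.
apply: (@near_eq_is_derive _ _ _ (\sum_i h i)).
  apply: filterS VE => s ->; rewrite phis fct_sumE.
  by apply: eq_bigr => i _; rewrite phiZ.
apply: is_derive_sum => i.
have da' : is_derive t 1 (a i) ((a i)^`()%classic t).
  by rewrite derive1E; exact: derivableP.
have D := is_deriveM da' (is_derive_curve sg (sphi i)).
apply: (is_derive_eq (f := h i) D).
by rewrite addrC; congr (_ + _); exact: mulrC.
Qed.

Lemma is_derive0_eq (h : R -> R) : (forall t, 0 <= t <= 1 -> is_derive t 1 h 0) ->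
  h 1 = h 0.
Proof.
move=> dh.
have dh' t : t \in `]0, 1[ -> is_derive t 1 h ((fun=> 0 : R) t).
  by move=> /subset_itv_oo_cc; rewrite in_itv /=; exact: dh.
have ch : {within `[0, 1], continuous h}.
  by apply: derivable_within_continuous => t; rewrite in_itv /= => /dh[].
have [c _ /eqP] := MVT_segment ler01 dh' ch.
by rewrite mul0r subr_eq0 => /eqP.
Qed.

End Curves.

(** * The connection of a holomorphic coframe *)

Section CoframeConnection.
Context {R : realType} {n : nat} {M : manifold R (n + n)} (J : almost_complex M).
Hypothesis J_integrable : integrable_acs J.
Variable alpha : 'I_n -> cform1 M.
Hypothesis alpha_hol : forall k, holomorphic_form J (alpha k).
Hypothesis alpha_indep : forall (p : M) (a : 'I_n -> R[i]),
  (forall z : ctangent p, \sum_k a k * alpha k p z = 0) -> forall k, a k = 0.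
Implicit Types (c : chart R (n + n) M) (p q : M).

Definition coframe k p (v : tangent p) : R[i] := alpha k p ((v, 0) : ctangent p).

Lemma coframeD k p (u v : tangent p) : coframe k (u + v) = coframe k u + coframe k v.
Proof.
rewrite /coframe -linearD; congr (alpha k p _).
by rewrite -[RHS]/((u + v, 0 + 0)) addr0.
Qed.

Lemma coframeZ k p (r : R) (u : tangent p) : coframe k (r *: u) = r%:C%C * coframe k u.
Proof.
rewrite /coframe -[RHS]/(r%:C%C *: (alpha k p (u, 0) : R[i]^o)) -linearZ.
congr (alpha k p _); rewrite complexification_scaleE /=.
by rewrite !scaler0 scale0r subr0 addr0.
Qed.

Lemma coframeJ k p (u : tangent p) : coframe k (J p u) = 'i%C * coframe k u.
Proof.
have [t10 _] := alpha_hol k.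
have t01 : type01 J ((u, J p u) : ctangent p) by exact/type01P.
have := t10 p _ t01.
have -> : ((u, J p u) : ctangent p) = 'i%C *: ((J p u, 0) : ctangent p) + (u, 0).
  rewrite complexification_scaleE /= !scale0r !scale1r subr0 add0r.
  by rewrite -[RHS]/((0 + u, J p u + 0)) add0r addr0.
rewrite linearD linearZ /= => /eqP; rewrite addrC addr_eq0 => /eqP E.
apply: (mulfI (@i_neq0 R)); rewrite mulrA mulii mulN1r /coframe E opprK.
by [].
Qed.

Lemma coframeN k p (u : tangent p) : coframe k (- u) = - coframe k u.
Proof. by rewrite -scaleN1r coframeZ rmorphN1 mulN1r. Qed.

Lemma coframeB k p (u v : tangent p) : coframe k (u - v) = coframe k u - coframe k v.
Proof. by rewrite coframeD coframeN. Qed.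

Lemma coframe0 k p : coframe k (0 : tangent p) = 0.
Proof. by rewrite -(scale0r 0) coframeZ rmorph0 mul0r. Qed.

Lemma coframe_complex k p (z : ctangent p) :
  alpha k p z = coframe k z.1 + 'i%C * coframe k z.2.
Proof.
case: z => u v; rewrite /coframe.
rewrite -[RHS]/(alpha k p (u, 0) + 'i%C *: (alpha k p (v, 0) : R[i]^o)) -linearZ -linearD.
congr (alpha k p _); rewrite complexification_scaleE /= !scale0r !scale1r subr0 add0r.
by rewrite -[RHS]/((u + 0, 0 + v)) add0r addr0.
Qed.

Lemma coframe_cmul k p (r : R[i]) (u : tangent p) :
  coframe k (cmul J r u) = r * coframe k u.
Proof.
rewrite /cmul coframeD !coframeZ coframeJ mulrA -mulrDl.
by rewrite [X in (_ + X) * _]mulrC -complexE.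
Qed.

Lemma coframe_sum k p (I : Type) (s : seq I) (F : I -> tangent p) :
  coframe k (\sum_(i <- s) F i) = \sum_(i <- s) coframe k (F i).
Proof.
by elim: s => [|i s IH]; rewrite ?big_nil ?coframe0 // !big_cons coframeD IH.
Qed.

Lemma coframe_local c p : holomorphic_chart J c -> chart_dom c p ->
  exists F : M -> 'M[R[i]]_n,
    [/\ forall k j, csmooth_fun_at (fun q => F q k j) p,
        \forall q \near p, F q \in unitmx &
        \forall q \near p, forall k (v : tangent q),
          coframe k v = \sum_j F q k j * cderiv v (zcoord c j)].
Proof.
move=> hc cp.
have /choice[f fP] k : exists f : 'I_n -> M -> R[i],
       (forall j, holomorphic_fun_at J (f j) p) /\
       \forall q \near p, forall z : ctangent q,
         alpha k q z = \sum_j f j q * capply z (zcoord c j).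
  by have [_ /(_ c p hc cp)] := alpha_hol k.
have near_f : \forall q \near p, forall k (z : ctangent q),
    alpha k q z = \sum_j f k j q * capply z (zcoord c j).
  by apply: filter_forall => k; have [] := fP k.
exists (fun q => \matrix_(k, j) f k j q); split.
- move=> k j; under eq_fun do rewrite mxE.
  by have [/(_ j) []] := fP k.
- apply: filterS near_f => q fq; apply: unitmx_of_ker => a aF.
  apply/rowP => k; rewrite mxE; apply: (alpha_indep (p := q)) => z.
  under eq_bigr => l _ do rewrite fq mulr_sumr.
  rewrite exchange_big big1 // => j _.
  under eq_bigr => l _ do rewrite mulrA.
  rewrite -mulr_suml; have /rowP /(_ j) := aF; rewrite !mxE => aFj.
  rewrite (_ : \sum_l _ = 0) ?mul0r // -[RHS]aFj.
  by apply: eq_bigr => l _; rewrite mxE.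
- apply: filterS near_f => q fq k v; rewrite /coframe fq.
  by apply: eq_bigr => j _; rewrite mxE capply_real.
Qed.

Lemma coframe_inj p (u v : tangent p) :
  (forall k, coframe k u = coframe k v) -> u = v.
Proof.
move=> uv; have [c hc cp] := J_integrable p.
have [F [_ /nbhs_singleton uF /nbhs_singleton FE]] := coframe_local hc cp.
apply: (cderiv_zcoord_inj hc.1 cp) => j.
suff /colP /(_ j) : \col_j cderiv u (zcoord c j) = \col_j cderiv v (zcoord c j).
  by rewrite !mxE.
rewrite -[LHS](mulKmx uF) -[RHS](mulKmx uF); congr (_ *m _).
apply/colP => k; rewrite !mxE.
have := uv k; rewrite !FE => E.
by under eq_bigr do rewrite mxE; under [RHS]eq_bigr do rewrite mxE.
Qed.

Lemma coframe_surj p (a : 'I_n -> R[i]) :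
  exists u : tangent p, forall k, coframe k u = a k.
Proof.
have [c hc cp] := J_integrable p.
have [F [_ /nbhs_singleton uF /nbhs_singleton FE]] := coframe_local hc cp.
pose w := invmx (F p) *m \col_k a k.
exists (ztangent c p (fun j => w j 0)) => k; rewrite FE.
have /colP /(_ k) := mulKVmx uF (\col_k a k); rewrite -/w mxE [RHS]mxE => <-.
by apply: eq_bigr => j _; rewrite ztangentE //; exact: hc.1.
Qed.

Definition dual_frame (k : 'I_n) : vfield M :=
  fun p => sval (cid (coframe_surj p (fun l => (l == k)%:R))).

Lemma dual_frameE k l p : coframe l (dual_frame k p) = (l == k)%:R.
Proof. by rewrite /dual_frame; case: cid. Qed.

Lemma dual_frame_smooth k p : smooth_vfield_at (dual_frame k) p.
Proof.
have [c hc cp] := J_integrable p; have [F [sF uF FE]] := coframe_local hc cp.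
pose w j q := (\det (F q))^-1 * (\adj (F q)) j k.
apply: (@smooth_vfield_congr _ _ _ (fun q => ztangent c q (fun j => w j q))).
  have := near_chart_dom cp; apply: filterS3 uF FE => q uFq FEq cq.
  apply: coframe_inj => l; rewrite dual_frameE FEq.
  have /matrixP /(_ l k) := mulmxV uFq; rewrite !mxE => <-.
  apply: eq_bigr => j _; rewrite ztangentE //; last exact: hc.1.
  by rewrite /invmx uFq mxE.
apply: smooth_ztangent => // [|j]; first exact: hc.1.
apply: (inv_mx_closed (p := p) (P := fun f => csmooth_fun_at f p)) => //.
- by move=> ?; exact: csmooth_cst.
- by move=> f g; exact: csmoothD.
- by move=> f g; exact: csmoothM.
- by move=> f; exact: csmoothV.
- exact: nbhs_singleton uF.
Qed.

Lemma coframe_smooth k (Y : vfield M) p : smooth_vfield_at Y p ->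
  csmooth_fun_at (fun q => coframe k (Y q)) p.
Proof.
move=> sY; have [c hc cp] := J_integrable p; have [F [sF uF FE]] := coframe_local hc cp.
apply: (@csmooth_congr _ _ _ (fun q => \sum_j F q k j * cderiv (Y q) (zcoord c j))).
  by apply: filterS FE => q ->.
apply: csmooth_sum => j; apply: csmoothM => //.
by apply: csmooth_cderiv => //; exact: csmooth_zcoord hc.1 cp.
Qed.

Definition coframe_vect p (a : 'I_n -> R[i]) : tangent p :=
  \sum_k cmul J (a k) (dual_frame k p).

Lemma coframe_vectE k p (a : 'I_n -> R[i]) : coframe k (coframe_vect p a) = a k.
Proof.
rewrite coframe_sum (bigD1 k) //= coframe_cmul dual_frameE eqxx mulr1.
rewrite big1 ?addr0 // => l /negPf lk.
by rewrite coframe_cmul dual_frameE eq_sym lk mulr0.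
Qed.

Lemma coframe_vect_smooth p (a : 'I_n -> M -> R[i]) :
  (forall k, csmooth_fun_at (a k) p) ->
  smooth_vfield_at (fun q => coframe_vect q (fun k => a k q)) p.
Proof.
move=> sa; apply: smooth_vfield_sum => k; have [s1 s2] := sa k.
apply: smooth_vfieldD; apply: smooth_vfieldM => //; first exact: dual_frame_smooth.
exact/acs_smooth/dual_frame_smooth.
Qed.

(** The connection which makes the dual frame parallel: its components on the
    coframe are the derivatives of the components of Y. *)
Definition coframe_nabla p (v : tangent p) (Y : vfield M) : tangent p :=
  coframe_vect p (fun k => cderiv v (fun q => coframe k (Y q))).

Lemma coframe_nablaE k p (v : tangent p) (Y : vfield M) :
  coframe k (coframe_nabla v Y) = cderiv v (fun q => coframe k (Y q)).
Proof. exact: coframe_vectE. Qed.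

Fact coframe_nabla_linear (p : M) (a : R) (u v : tangent p) (Y : vfield M) :
  smooth_vfield_at Y p ->
  coframe_nabla (a *: u + v) Y = a *: coframe_nabla u Y + coframe_nabla v Y.
Proof.
move=> sY; apply: coframe_inj => k.
by rewrite coframeD coframeZ !coframe_nablaE cderivDl cderivZl.
Qed.

Fact coframe_nabla_add (p : M) (v : tangent p) (Y Z : vfield M) :
  smooth_vfield_at Y p -> smooth_vfield_at Z p ->
  coframe_nabla v (fun q => Y q + Z q) = coframe_nabla v Y + coframe_nabla v Z.
Proof.
move=> sY sZ; apply: coframe_inj => k; rewrite coframeD !coframe_nablaE.
by under [X in cderiv _ X]eq_fun do rewrite coframeD;
   rewrite cderivD //; exact: coframe_smooth.
Qed.

Fact coframe_nabla_leibniz (p : M) (v : tangent p) (f : M -> R) (Y : vfield M) :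
  smooth_fun_at f p -> smooth_vfield_at Y p ->
  coframe_nabla v (fun q => f q *: Y q) = v f *: Y p + f p *: coframe_nabla v Y.
Proof.
move=> sf sY; apply: coframe_inj => k; rewrite coframeD !coframeZ !coframe_nablaE.
under [X in cderiv _ X]eq_fun do rewrite coframeZ.
rewrite cderivM; last exact: coframe_smooth.
  have -> : cderiv v (fun q => (f q)%:C%C) = (v f)%:C%C.
    by apply: complex_ext => //=; rewrite tangent_cst.
  by rewrite addrC [X in X + _]mulrC.
by split=> //; exact: smooth_fun_cst.
Qed.

Fact coframe_nabla_smooth (p : M) (X Y : vfield M) :
  smooth_vfield_at X p -> smooth_vfield_at Y p ->
  smooth_vfield_at (fun q => coframe_nabla (X q) Y) p.
Proof.
move=> sX sY; apply: coframe_vect_smooth => k.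
by apply: csmooth_cderiv => //; exact: coframe_smooth.
Qed.

Definition coframe_connection : connection M :=
  Connection coframe_nabla_linear coframe_nabla_add coframe_nabla_leibniz
    coframe_nabla_smooth.

Lemma coframe_connection_complex : complex_connection coframe_connection J.
Proof.
move=> p v Y sY; apply: coframe_inj => k; rewrite /= coframeJ !coframe_nablaE.
rewrite -cderivZ; last exact: coframe_smooth.
by under [X in cderiv _ X]eq_fun do rewrite coframeJ.
Qed.

(** On real fields, coframe k maps the torsion to d (alpha k). As X + i J X is
    of type (0,1), d (alpha k) vanishes on it, which is the complex linearity in
    X. *)
Lemma coframe_connection_torsion : (forall k, d_type20 J (alpha k)) ->
  torsion_type20 coframe_connection J.
Proof.
move=> d20 X Y p sX sY; apply: coframe_inj => k.
have sJX : smooth_vfield_at (Jfield J X) p by exact: acs_smooth.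
pose d (V : vfield M) := cderiv (V p) (fun q => coframe k (Y q))
   - cderiv (Y p) (fun q => coframe k (V q)) - coframe k (lie_bracket V Y p).
have torsionE (V : vfield M) : coframe k (torsion coframe_connection V Y p) = d V.
  by rewrite /torsion !coframeB; congr (_ - _ - _); exact: coframe_nablaE.
rewrite coframeJ !torsionE.
pose Z : cvfield M := fun q => (X q, J q (X q)).
pose W : cvfield M := fun q => (Y q, 0).
have t01 : type01 J (Z p) by exact/type01P.
have sW : csmooth_vfield_at W p by split=> //; exact: smooth_vfield0.
have sZ : csmooth_vfield_at Z p by [].
have dk := d20 k Z W p sZ sW t01.
suff E : d X + 'i%C * d (Jfield J X) = 0.
  apply: (mulfI (@i_neq0 R)); rewrite mulrA mulii mulN1r.
  by move/eqP: E; rewrite addrC addr_eq0 => /eqP.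
have lie : clie_bracket Z W p = (lie_bracket X Y p, lie_bracket (Jfield J X) Y p).
  by rewrite /clie_bracket /= !lie_bracket0 // subr0 add0r.
have alphaZ : capply (W p) (fun q => alpha k q (Z q)) =
    cderiv (Y p) (fun q => coframe k (X q))
    + 'i%C * cderiv (Y p) (fun q => coframe k (Jfield J X q)).
  rewrite capply_real; under [X in cderiv _ X]eq_fun do rewrite coframe_complex.
  rewrite cderivD ?cderivZ //; try exact: coframe_smooth.
  by apply: csmoothM; [exact: csmooth_cst|exact: coframe_smooth].
rewrite -[RHS]dk /cform1_d lie alphaZ coframe_complex capplyE /d /coframe /=.
by rewrite !mulrBr; ring.
Qed.

(** The real and imaginary parts of the components of a parallel field on the
    coframe have zero derivative. *)
Lemma coframe_along (g : R -> M) (V : forall t, tangent (g t)) k :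
  smooth_curve g -> parallel_along coframe_connection V ->
  coframe k (V 1) = coframe k (V 0).
Proof.
move=> sg pV.
have component (pr : R[i] -> R) : (forall x y, pr (x + y) = pr x + pr y) ->
    (forall r x, pr (r%:C%C * x) = r * pr x) ->
    (forall f p, csmooth_fun_at f p -> smooth_fun_at (fun q : M => pr (f q)) p) ->
    (forall p (v : tangent p) f, pr (cderiv v f) = v (fun q => pr (f q))) ->
    pr (coframe k (V 1)) = pr (coframe k (V 0)).
  move=> prD prZ pr_smooth pr_cderiv.
  apply: (@is_derive0_eq _ (fun s => pr (coframe k (V s)))) => t t01.
  have [N [E [a [sE da VE w0]]]] := pV t t01.
  have prE i : smooth_fun_at (fun q => pr (coframe k (E i q))) (g t).
    by apply: pr_smooth; exact: coframe_smooth.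
  have prDk q (u v : tangent q) : pr (coframe k (u + v)) = pr (coframe k u) + pr (coframe k v).
    by rewrite coframeD prD.
  have prZk q r (u : tangent q) : pr (coframe k (r *: u)) = r * pr (coframe k u).
    by rewrite coframeZ prZ.
  apply: is_derive_eq (is_derive_along (phi := fun q u => pr (coframe k u))
    (sg t t01) prDk prZk prE da VE) _.
  have pr0 : pr 0 = 0 by rewrite -(mul0r 0) -(rmorph0 (real_complex R)) prZ mul0r.
  rewrite -[RHS]pr0 -(coframe0 k (g t)) w0 coframe_sum (big_morph pr prD pr0).
  apply: eq_bigr => i _; rewrite coframeD !coframeZ prD !prZ; congr (_ + _ * _).
  by rewrite coframe_nablaE pr_cderiv.
apply: complex_ext; apply: component => //.
- exact: ReD.
- by move=> r x; rewrite ReM /= mul0r subr0.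
- by move=> f p [].
- exact: ImD.
- by move=> r x; rewrite ImM /= mul0r addr0.
- by move=> f p [].
Qed.

Lemma coframe_transport gs p q (u : tangent p) (v : tangent q) k :
  parallel_transport coframe_connection gs u v -> coframe k u = coframe k v.
Proof.
by move=> PT; elim: PT => // g gs' r V w sg pV _ <-; rewrite (coframe_along k sg pV).
Qed.

Lemma coframe_vect_parallel (g : R -> M) a :
  parallel_along coframe_connection (fun t => coframe_vect (g t) a).
Proof.
move=> t _; exists 1%N, (fun _ q => coframe_vect q a), (fun _ _ => 1); split.
- move=> _; apply: (coframe_vect_smooth (a := fun k _ => a k)) => k; exact: csmooth_cst.
- by move=> _; exact: derivable_cst.
- by apply: filterE => s; rewrite big_ord1 scale1r.
rewrite big_ord1 derive1_cst scale0r add0r scale1r; apply: coframe_inj => k /=.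
rewrite coframe_nablaE; under [X in cderiv _ X]eq_fun do rewrite coframe_vectE.
by rewrite cderiv_cst coframe0.
Qed.

Lemma coframe_vect_transport gs p q a : piecewise_smooth_path gs p q ->
  parallel_transport coframe_connection gs (coframe_vect p a) (coframe_vect q a).
Proof.
elim: gs p => [|g gs IH] p /=; first by move=> ->; exact: ParallelNil.
move=> [sg <- /IH]; apply: (ParallelCons (V := fun t => coframe_vect (g t) a)) => //.
exact: coframe_vect_parallel.
Qed.

Lemma coframe_connection_holonomy : trivial_holonomy coframe_connection.
Proof.
move=> p gs pgs u v; split=> [uv|->].
  by apply: coframe_inj => k; exact: coframe_transport uv.
have -> : v = coframe_vect p (fun k => coframe k v).
  by apply: coframe_inj => k; rewrite coframe_vectE.
exact: coframe_vect_transport.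
Qed.

End CoframeConnection.

(** * Affine reparametrization of curves, connections in charts *)

Section AffineReparametrization.
Context {R : realType}.

Lemma class_CZ (V W : normedModType R) k (r : R) (f : V -> W) (A : set V) : open A ->
  class_C k f A -> class_C k (fun x => r *: f x) A.
Proof.
move=> oA; elim: k f => [|k IH] f /=.
  by move=> fc x Ax; exact/continuousZl_tmp/fc.
move=> [df Df]; split=> [x Ax|v]; first by apply: differentiableZ; exact: df.
apply: class_C_congr oA _ (IH _ (Df v)) => x Ax.
by rewrite deriveZ //; exact/diff_derivable/df.
Qed.

Lemma differentiable_affine (a b t : R) : differentiable (fun s : R => a * s + b) t.
Proof.
apply: differentiableD; last exact: differentiable_cst.
by apply: differentiableM; [exact: differentiable_cst|exact: ex_diff].
Qed.

Lemma derive_affine (W : normedModType R) (f : R -> W) (a b t v : R) :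
  differentiable f (a * t + b) ->
  'D_v (fun s => f (a * s + b)) t = a *: 'D_v f (a * t + b).
Proof.
move=> df; have da := differentiable_affine a b t.
have dc : differentiable (f \o (fun s : R => a * s + b)) t by exact: differentiable_comp.
rewrite -[LHS]/('D_v (f \o (fun s : R => a * s + b)) t) deriveE // diff_comp //=.
rewrite deriveE // -linearZ; congr ('d f _ _); rewrite -deriveE //.
have d1 : derivable (fun s : R => a * s) t v.
  by apply: derivableM; [exact: derivable_cst|exact: derivable_id].
rewrite (deriveD d1 (derivable_cst b t v)).
have -> : 'D_v (fun s : R => a * s) t = a *: 'D_v id t by exact/deriveZ/derivable_id.
by rewrite derive_cst derive_id addr0.
Qed.

Lemma class_C_affine (W : normedModType R) k (f : R -> W) (a b : R) (A : set R) :
  open A -> class_C k f A ->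
  class_C k (fun s => f (a * s + b)) ((fun s => a * s + b) @^-1` A).
Proof.
move=> oA; have ca : continuous (fun s : R => a * s + b).
  by move=> t; exact/differentiable_continuous/differentiable_affine.
have oB : open ((fun s => a * s + b) @^-1` A) by exact: open_comp.
elim: k f => [|k IH] f /=.
  by move=> fc x Ax; apply: (@continuous_comp _ _ _ (fun s => a * s + b) f);
    [exact: ca|exact: fc].
move=> [df Df]; split=> [x Ax|v].
  apply: (@differentiable_comp _ _ _ _ (fun s => a * s + b) f).
    exact: differentiable_affine.
  exact: df.
apply: class_C_congr oB _ (class_CZ a oB (IH _ (Df v))) => x Ax.
by rewrite derive_affine //; exact: df.
Qed.

Lemma smooth_at_affine (W : normedModType R) (f : R -> W) (a b t : R) :
  smooth_at f (a * t + b) -> smooth_at (fun s => f (a * s + b)) t.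
Proof.
move=> [A [oA At CA]]; exists ((fun s => a * s + b) @^-1` A); split=> //.
  apply: open_comp => // s _.
  exact/differentiable_continuous/differentiable_affine.
by move=> k; exact: class_C_affine.
Qed.

Lemma smooth_at_line m (x v : 'rV[R]_m) (t : R) :
  smooth_at (fun s : R => x + s *: v) t.
Proof.
apply/smooth_at_coord => i; under eq_fun do rewrite !mxE.
apply: smooth_atD; first exact: smooth_at_cst.
by apply: smooth_atM; [exact: smooth_at_id|exact: smooth_at_cst].
Qed.

End AffineReparametrization.

Section AffineCurves.
Context {R : realType} {m : nat} {M : manifold R m}.
Implicit Types (g : R -> M) (t a b : R).

Definition affine_curve a b g : R -> M := fun t => g (a * t + b).

Lemma smooth_affine_curve a b g t :
  smooth_curve_at g (a * t + b) -> smooth_curve_at (affine_curve a b g) t.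
Proof.
move=> [cg sg]; split.
  apply: (@continuous_comp _ _ _ (fun s => a * s + b) g) => //.
  exact/differentiable_continuous/differentiable_affine.
by move=> c ac cg'; apply: (smooth_at_affine (f := c \o g)); exact: sg.
Qed.

Lemma velocity_affine a b g t : smooth_curve_at g (a * t + b) ->
  velocity (affine_curve a b g) t = a *: velocity g (a * t + b).
Proof.
move=> sg; apply/val_inj/funext => f.
rewrite -[RHS]/((a *: velocity g (a * t + b)) f) tangent_valZ /=.
have [sf|nsf] := pselect (smooth_fun_at f (g (a * t + b))); last first.
  by rewrite !tangent_nonsmooth ?mulr0.
have [D1 E1] := is_derive_curve (smooth_affine_curve sg) sf.
have [D2 E2] := is_derive_curve sg sf.
rewrite -E1 -E2 -[LHS]/('D_1 (fun s => (f \o g) (a * s + b)) t).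
by rewrite derive_affine //; exact/derivable1_diffP.
Qed.

Variable D : connection M.

Lemma nabla0l p (Y : vfield M) : smooth_vfield_at Y p -> D p 0 Y = 0.
Proof.
move=> sY; have := nabla_linear D 1 0 0 sY; rewrite !scale1r addr0.
by move=> /eqP; rewrite -subr_eq subrr eq_sym => /eqP.
Qed.

Lemma nablaZl p (r : R) (v : tangent p) (Y : vfield M) : smooth_vfield_at Y p ->
  D p (r *: v) Y = r *: D p v Y.
Proof.
by move=> sY; have := nabla_linear D r v 0 sY; rewrite nabla0l // !addr0.
Qed.

Lemma nabla_suml p (I : Type) (s : seq I) (a : I -> R) (u : I -> tangent p) (Y : vfield M) :
  smooth_vfield_at Y p ->
  D p (\sum_(i <- s) a i *: u i) Y = \sum_(i <- s) a i *: D p (u i) Y.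
Proof.
move=> sY; elim: s => [|i s IH]; first by rewrite !big_nil nabla0l.
by rewrite !big_cons nabla_linear // IH.
Qed.

Lemma nabla0r p (v : tangent p) : D p v (fun q => 0 : tangent q) = 0.
Proof.
have s0 := @smooth_vfield0 _ _ M p; have := nabla_add D v s0 s0.
rewrite (_ : (fun q : M => _) = (fun q => 0 : tangent q)); last first.
  by apply: functional_extensionality_dep => q; rewrite addr0.
by move=> /eqP; rewrite -subr_eq subrr eq_sym => /eqP.
Qed.

(** The Leibniz rule with the indicator function of the set where X and Y agree:
    it is constant near p, hence has derivative 0 at p, and the products with X
    and Y are equal. *)
Lemma nabla_congr p (v : tangent p) (X Y : vfield M) : smooth_vfield_at X p ->
  {near p, forall q, X q = Y q} -> D p v X = D p v Y.
Proof.
move=> sX XY; have sY := smooth_vfield_congr XY sX.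
pose f q : R := if `[< X q = Y q >] then 1 else 0.
have f1 : {near p, (fun=> 1) =1 f} by apply: filterS XY => q E; rewrite /f asboolT.
have sf : smooth_fun_at f p := smooth_fun_congr f1 (@smooth_fun_cst _ _ M 1 p).
have fp : f p = 1 by rewrite -(nbhs_singleton f1).
have vf : v f = 0 by rewrite -(tangent_congr v f1) tangent_cst.
have fXY : (fun q => f q *: X q) = (fun q => f q *: Y q).
  apply: functional_extensionality_dep => q; rewrite /f.
  by case: asboolP => [->|_] //; rewrite !scale0r.
have := nabla_leibniz D v sf sX; rewrite fXY (nabla_leibniz D v sf sY).
by rewrite vf fp !scale0r !add0r !scale1r.
Qed.

Lemma nabla_sum_leibniz p (v : tangent p) (I : Type) (s : seq I) (f : I -> M -> R)
    (E : I -> vfield M) :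
  (forall i, smooth_fun_at (f i) p) -> (forall i, smooth_vfield_at (E i) p) ->
  D p v (fun q => \sum_(i <- s) f i q *: E i q) =
  \sum_(i <- s) (v (f i) *: E i p + f i p *: D p v (E i)).
Proof.
move=> sf sE; elim: s => [|i s IH].
  rewrite big_nil (_ : (fun q : M => _) = (fun q => 0 : tangent q)) ?nabla0r //.
  by apply: functional_extensionality_dep => q; rewrite big_nil.
rewrite big_cons -IH -nabla_leibniz // -nabla_add; first last.
- by apply: smooth_vfield_sum => j; exact: smooth_vfieldM.
- exact: smooth_vfieldM.
by congr (D p v _); apply: functional_extensionality_dep => q; rewrite big_cons.
Qed.

Definition partial_field (c : chart R m M) (i : 'I_m) : vfield M :=
  fun q => chart_tangent c q (delta_mx 0 i).

Lemma partial_field_comb (c : chart R m M) p (a : 'I_m -> R) j :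
  smooth_chart c -> chart_dom c p ->
  (\sum_i a i *: partial_field c i p) (chart_coord c j) = a j.
Proof.
move=> sc cp; rewrite tangent_val_sum (bigD1 j) // big1 => [|i /negPf ij].
  by rewrite Monoid.mulm1 tangent_valZ chart_tangent_coord // mxE !eqxx mulr1.
by rewrite tangent_valZ chart_tangent_coord // mxE eq_sym ij andbF mulr0.
Qed.

Lemma tangent_partialE (c : chart R m M) p (v : tangent p) :
  smooth_chart c -> chart_dom c p ->
  v = \sum_i v (chart_coord c i) *: partial_field c i p.
Proof.
move=> sc cp; apply: (tangent_eqP sc cp) => j.
by rewrite partial_field_comb.
Qed.

Lemma nabla_chartE (c : chart R m M) p (v : tangent p) (Y : vfield M) j :
  smooth_chart c -> chart_dom c p -> smooth_vfield_at Y p ->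
  D p v Y (chart_coord c j) =
  v (fun q => Y q (chart_coord c j)) +
  \sum_i Y p (chart_coord c i) * D p v (partial_field c i) (chart_coord c j).
Proof.
move=> sc cp sY.
rewrite (@nabla_congr p v Y (fun q => \sum_i Y q (chart_coord c i) *: partial_field c i q)) //;
  last by apply: filterS (near_chart_dom cp) => q cq; exact: tangent_partialE.
rewrite nabla_sum_leibniz; first last.
- by move=> i; exact: smooth_chart_tangent.
- by move=> i; exact: smooth_vfield_coord.
by rewrite big_split tangent_valD partial_field_comb // tangent_val_sum.
Qed.

(** In a chart a covariant derivative along a curve is the derivative of the
    components corrected by connection coefficients; so it depends on the field
    along the curve only, not on the ambient fields used to express it. *)
Lemma covariant_derivative_coord (c : chart R m M) g t (V : forall s, tangent (g s))
    (w : tangent (g t)) j :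
  smooth_chart c -> chart_dom c (g t) -> smooth_curve_at g t ->
  is_covariant_derivative D V w ->
  is_derive t 1 (fun s => V s (chart_coord c j))
    (w (chart_coord c j) - \sum_i V t (chart_coord c i) *
      D (g t) (velocity g t) (partial_field c i) (chart_coord c j)).
Proof.
move=> sc cgt sg [k [E [a [sE da VE wE]]]].
apply: is_derive_eq (is_derive_along
  (phi := fun q (u : tangent q) => u (chart_coord c j)) sg _ _ _ da VE) _ => //.
  by move=> i; exact: smooth_vfield_coord.
have Vt : V t = \sum_i a i t *: E i (g t) := nbhs_singleton VE.
pose G l := D (g t) (velocity g t) (partial_field c l) (chart_coord c j).
have -> : \sum_l V t (chart_coord c l) * G l =
    \sum_i a i t * \sum_l E i (g t) (chart_coord c l) * G l.
  rewrite Vt; under eq_bigr => l _ do rewrite tangent_val_sum mulr_suml.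
  rewrite exchange_big; apply: eq_bigr => i _; rewrite mulr_sumr.
  by apply: eq_bigr => l _; rewrite tangent_valZ mulrA.
rewrite wE tangent_val_sum -sumrB; apply: eq_bigr => i _.
by rewrite tangent_valD !tangent_valZ (nabla_chartE _ _ sc cgt (sE i)) mulrDr addrA addrK.
Qed.

Lemma parallel_affine a b g (V : forall t, tangent (g t)) :
  (forall t, 0 <= t <= 1 -> 0 <= a * t + b <= 1) -> smooth_curve g ->
  parallel_along D V ->
  parallel_along D (fun t => V (a * t + b) : tangent (affine_curve a b g t)).
Proof.
move=> ab sg pV t t01; have ab01 := ab t t01; have sgt := sg _ ab01.
have [k [E [f [sE df VE w0]]]] := pV _ ab01.
have ca : {for t, continuous (fun s : R => a * s + b)}.
  exact/differentiable_continuous/differentiable_affine.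
exists k, E, (fun i s => f i (a * s + b)); split.
- by [].
- move=> i; apply/derivable1_diffP.
  apply: (@differentiable_comp _ _ _ _ (fun s => a * s + b) (f i)).
    exact: differentiable_affine.
  exact/derivable1_diffP.
- exact: ca VE.
have aw0 := congr1 (fun w : tangent (g (a * t + b)) => a *: w) w0.
rewrite /= scaler0 scaler_sumr in aw0.
apply: (etrans aw0); apply: eq_bigr => i _.
have fE : derive1 (fun s => f i (a * s + b)) t = a * derive1 (f i) (a * t + b).
  by rewrite !derive1E; apply: (derive_affine (f := f i)); exact/derivable1_diffP.
by rewrite fE velocity_affine // nablaZl // scalerDr !scalerA [a * f i _]mulrC.
Qed.

End AffineCurves.

(** * Parallel transport when the holonomy is trivial *)

Section Transport.
Context {R : realType} {m : nat} {M : manifold R m} (D : connection M).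
Implicit Types (g : R -> M) (gs : seq (R -> M)) (p q : M).

Definition tangent_point := {p : M & tangent p}.
Definition tpoint p (v : tangent p) : tangent_point := existT _ p v.

(** The relation parallel_transport, stated on the total space of the tangent
    bundle: with the base points inside the data, paths are concatenated and
    reversed without carrying vectors along equalities of points. *)
Fixpoint transported gs (s s' : tangent_point) : Prop :=
  if gs is g :: gs' then
    exists V : forall t, tangent (g t),
      [/\ smooth_curve g, parallel_along D V, s = tpoint (V 0)
        & transported gs' (tpoint (V 1)) s']
  else s = s'.

Lemma parallel_transport_transported gs p q (u : tangent p) (v : tangent q) :
  parallel_transport D gs u v -> transported gs (tpoint u) (tpoint v).
Proof. by elim=> // g gs' r V w sg pV _ IH; exists V. Qed.

Lemma transported_parallel_transport gs (s s' : tangent_point) :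
  transported gs s s' -> parallel_transport D gs (projT2 s) (projT2 s').
Proof.
elim: gs s => [|g gs IH] s /=; first by move=> ->; exact: ParallelNil.
by move=> [V [sg pV -> /IH]]; exact: ParallelCons.
Qed.

Lemma transported_cat gs gs' s s'' :
  transported (gs ++ gs') s s'' <->
  exists s', transported gs s s' /\ transported gs' s' s''.
Proof.
elim: gs s => [|g gs IH] s /=; first by split=> [H|[s' [-> //]]]; exists s.
split=> [[V [sg pV -> /IH[s' [H1 H2]]]]|[s' [[V [sg pV -> H1]] H2]]].
  by exists s'; split=> //; exists V.
by exists V; split=> //; apply/IH; exists s'.
Qed.

Lemma transported_path gs s s' : transported gs s s' ->
  piecewise_smooth_path gs (projT1 s) (projT1 s').
Proof.
elim: gs s => [|g gs IH] s /=; first by move=> ->.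
by move=> [V [sg pV -> /IH]].
Qed.

Lemma path_end gs p q q' : piecewise_smooth_path gs p q ->
  piecewise_smooth_path gs p q' -> q = q'.
Proof.
elim: gs p => [|g gs IH] p /=; first by move=> <-.
by move=> [_ _ /IH H] [_ _ /H].
Qed.

Lemma path_cat gs gs' p q r : piecewise_smooth_path gs p q ->
  piecewise_smooth_path gs' q r -> piecewise_smooth_path (gs ++ gs') p r.
Proof.
elim: gs p => [|g gs IH] p /=; first by move=> ->.
by move=> [sg g0 /IH H] /H; split.
Qed.

Definition reverse_curve g : R -> M := affine_curve (-1) 1 g.
Definition reverse_path gs := rev (map reverse_curve gs).

Lemma reverse01 (t : R) : 0 <= t <= 1 -> 0 <= -1 * t + 1 <= 1.
Proof. by move=> /andP[t0 t1]; apply/andP; split; lra. Qed.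

Lemma smooth_reverse_curve g : smooth_curve g -> smooth_curve (reverse_curve g).
Proof. by move=> sg t t01; apply: smooth_affine_curve; exact/sg/reverse01. Qed.

Lemma path_reverse gs p q : piecewise_smooth_path gs p q ->
  piecewise_smooth_path (reverse_path gs) q p.
Proof.
elim: gs p => [|g gs IH] p /=; first by move=> ->.
move=> [sg <- /IH H]; rewrite /reverse_path /= rev_cons -cats1.
apply: path_cat H _ => /=; split; first exact: smooth_reverse_curve.
  by rewrite /reverse_curve /affine_curve mulr0 add0r.
by rewrite /reverse_curve /affine_curve mulr1 addNr.
Qed.

Lemma tpoint_curve g (V : forall t, tangent (g t)) (t t' : R) : t = t' ->
  tpoint (V t) = tpoint (V t').
Proof. by move=> ->. Qed.

Lemma transported_reverse gs s s' : transported gs s s' ->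
  transported (reverse_path gs) s' s.
Proof.
elim: gs s => [|g gs IH] s /=; first by move=> ->.
move=> [V [sg pV -> /IH H]]; rewrite /reverse_path /= rev_cons -cats1.
apply/transported_cat; exists (tpoint (V 1)); split => //=.
exists (fun t => V (-1 * t + 1)); split.
- exact: smooth_reverse_curve.
- by apply: parallel_affine => // t; exact: reverse01.
- by apply: tpoint_curve; rewrite mulr0 add0r.
- by apply/esym/tpoint_curve; rewrite mulr1 addNr.
Qed.

Hypothesis holonomy : trivial_holonomy D.

Lemma transported_loop gs p (u v : tangent p) :
  transported gs (tpoint u) (tpoint v) -> u = v.
Proof.
move=> H; have pgs := transported_path H.
exact: ((holonomy pgs u v).1 (transported_parallel_transport H)).
Qed.

(** Going back along gs and then along gs' is a loop. *)
Lemma transported_unique gs gs' s q (v v' : tangent q) :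
  transported gs s (tpoint v) -> transported gs' s (tpoint v') -> v = v'.
Proof.
move=> /transported_reverse H H'.
apply: (@transported_loop (reverse_path gs ++ gs')).
by apply/transported_cat; exists s.
Qed.

(** By trivial holonomy every vector is transported to itself along the loop
    made of the path and its reverse, so a parallel field exists along the loop,
    hence along its first half. This stands in for the existence theorem for
    linear differential equations. *)
Lemma transported_exists gs p q (u : tangent p) : piecewise_smooth_path gs p q ->
  exists v : tangent q, transported gs (tpoint u) (tpoint v).
Proof.
move=> pgs; have loop := path_cat pgs (path_reverse pgs).
have := parallel_transport_transported ((holonomy loop u u).2 erefl).
move=> /transported_cat[[q' v] [H _]].
by have /= q'E := path_end pgs (transported_path H); subst q'; exists v.
Qed.

Lemma parallel_field_along g (Y : vfield M) : smooth_vfield Y ->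
  (forall p (v : tangent p), D p v Y = 0) ->
  parallel_along D (fun t => Y (g t)).
Proof.
move=> sY Y0 t _; exists 1%N, (fun=> Y), (fun _ _ => 1); split.
- by move=> _; exact: sY.
- by move=> _; exact: derivable_cst.
- by apply: filterE => s; rewrite big_ord1 scale1r.
by rewrite big_ord1 derive1_cst scale0r add0r scale1r Y0.
Qed.

Lemma parallel_field_transported gs p q (Y : vfield M) : smooth_vfield Y ->
  (forall p (v : tangent p), D p v Y = 0) -> piecewise_smooth_path gs p q ->
  transported gs (tpoint (Y p)) (tpoint (Y q)).
Proof.
move=> sY Y0; elim: gs p => [|g gs IH] p /=; first by move=> ->.
move=> [sg <- /IH H]; exists (fun t => Y (g t)); split=> //.
exact: parallel_field_along.
Qed.

(** Along the reversed path, both Y p and 0 are the transport of 0. *)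
Lemma parallel_field_eq0 gs p q (Y : vfield M) : smooth_vfield Y ->
  (forall p (v : tangent p), D p v Y = 0) -> piecewise_smooth_path gs p q ->
  Y q = 0 -> Y p = 0.
Proof.
move=> sY Y0 pgs Yq.
have H := transported_reverse (parallel_field_transported sY Y0 pgs).
have H0 := transported_reverse (@parallel_field_transported gs p q (fun=> 0)
  (fun p => @smooth_vfield0 _ _ M p) (fun p v => nabla0r D v) pgs).
by rewrite Yq in H; exact: transported_unique H H0.
Qed.

End Transport.

(** * Piecewise smooth paths on a connected manifold *)

Section Reachability.
Context {R : realType} {m : nat} {M : manifold R m}.
Implicit Types (c : chart R m M) (p q : M).

Definition chart_image c : set 'rV[R]_m := c @` chart_dom c.

Lemma chart_imageP c x : chart_image c x -> chart_dom c (chart_inv c x) /\ c (chart_inv c x) = x.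
Proof. by move=> [q cq <-]; rewrite chart_mapK. Qed.

Lemma chart_segment_smooth c (x v : 'rV[R]_m) (t : R) : smooth_chart c ->
  chart_image c (x + t *: v) ->
  smooth_curve_at (fun s : R => chart_inv c (x + s *: v)) t.
Proof.
move=> sc /[dup] gx /chart_imageP[cq E]; have sl := smooth_at_line x v t.
split.
  apply: (@continuous_comp _ _ _ (fun s : R => x + s *: v) (chart_inv c)).
    exact: smooth_at_cont sl.
  by have := chart_inv_continuous cq; rewrite E.
move=> a aa aq; have := (sc a aa).1 _ cq aq; rewrite E => sac.
exact: (smooth_at_comp_rV (f := fun s : R => x + s *: v) (g := a \o chart_inv c)).
Qed.

Lemma ball_segment (x y z : 'rV[R]_m) (r t : R) : ball_ Num.norm x r y ->
  ball_ Num.norm x r z -> 0 <= t <= 1 -> ball_ Num.norm x r (y + t *: (z - y)).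
Proof.
rewrite /ball_ /= => xy xz /andP[t0 t1].
have -> : x - (y + t *: (z - y)) = (1 - t) *: (x - y) + t *: (x - z).
  by apply/rowP => i; rewrite !mxE; ring.
apply: (le_lt_trans (ler_normD _ _)); rewrite !normrZ.
have t1' : 0 <= 1 - t by rewrite subr_ge0.
rewrite (ger0_norm t1') (ger0_norm t0).
have [->|tn0] := eqVneq t 0; first by rewrite subr0 mul1r mul0r addr0.
have tp : 0 < t by rewrite lt_neqAle eq_sym tn0.
have -> : r = (1 - t) * r + t * r by ring.
by rewrite ler_ltD ?ler_wpM2l ?ltr_pM2l // ltW.
Qed.

Lemma chart_ball c p : chart_dom c p ->
  exists2 r : R, 0 < r & ball_ Num.norm (c p) r `<=` chart_image c.
Proof.
move=> cp; have : nbhs (c p) (chart_image c).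
  by apply: open_nbhs_nbhs; split; [exact: chart_im_open|exists p].
by move=> /nbhs_normP.
Qed.

(** Join the two points by a segment in a chart whose image contains a ball
    around the first one. *)
Lemma locally_reachable p : \forall q \near p,
  exists gs, piecewise_smooth_path gs p q.
Proof.
have [c ac cp] := atlas_cover p; have [r r0 rP] := chart_ball cp.
have : \forall x \near c p, ball_ Num.norm (c p) r x.
  by apply/nbhs_normP; exists r.
move=> /(near_chart_map cp); apply: filterS2 (near_chart_dom cp) => q cq bq.
exists [:: (fun t : R => chart_inv c (c p + t *: (c q - c p)))] => /=; split.
- move=> t t01; apply: chart_segment_smooth; first exact: atlas_smooth_chart.
  by apply/rP/ball_segment => //; rewrite /ball_ /= subrr normr0.
- by rewrite scale0r addr0 chart_mapK.
- by rewrite scale1r [c p + _]addrC subrK chart_mapK.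
Qed.

(** The points that can be reached from p form an open set, and so do the
    others, since near points are joined in both directions. *)
Lemma connected_reachable p q : connected [set: M] ->
  exists gs, piecewise_smooth_path gs p q.
Proof.
move=> cM; pose B : set M := [set q | exists gs, piecewise_smooth_path gs p q].
suff : B = setT by move=> /seteqP[_ /(_ q)]; exact.
have oB : open B.
  rewrite openE => x [gs pgs]; apply: filterS (locally_reachable x) => y [gs' pgs'].
  by exists (gs ++ gs'); exact: path_cat pgs pgs'.
have oB' : open (~` B).
  rewrite openE => x nx; apply: filterS (locally_reachable x) => y [gs' pgs'] [gs pgs].
  by apply: nx; exists (gs ++ reverse_path gs'); exact: path_cat pgs (path_reverse pgs').
apply: cM; first by exists p, [::].
  by exists B => //; rewrite setTI.
by exists B; [rewrite -[B]setCK; exact: open_closedC|rewrite setTI].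
Qed.

End Reachability.

(** * Smoothness of solutions of linear total systems *)

Section LinearSystems.
Context {R : realType}.

Lemma is_derive_scaled_direction (V : normedModType R) (f : V -> R) (x v : V) (r d : R) :
  is_derive x v f d -> is_derive x (r *: v) f (r * d).
Proof.
move=> df; have x0 (w : V) : x = x + 0 *: w by rewrite scale0r addr0.
rewrite (x0 v) in df; rewrite (x0 (r *: v)).
move/is_derive_lineP : df => [df dE]; apply/is_derive_lineP.
pose h s := f (x + s *: v).
have dh : differentiable h (r * 0 + 0) by rewrite mulr0 addr0; exact/derivable1_diffP.
have -> : (fun s => f (x + s *: (r *: v))) = (fun s => h (r * s + 0)).
  by apply/funext => s; rewrite /h addr0 scalerA mulrC.
split; last by rewrite derive_affine // mulr0 addr0 dE.
apply/derivable1_diffP; apply: (@differentiable_comp _ _ _ _ (fun s => r * s + 0) h) => //.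
Qed.

Lemma class_C_of_smooth_at (V W : normedModType R) k (f : V -> W) (A : set V) :
  (forall x, A x -> smooth_at f x) -> class_C k f A.
Proof.
elim: k f => [|k IH] f sf /=; first by move=> x /sf; exact: smooth_at_cont.
split=> [x /sf|v]; first exact: smooth_at_differentiable.
by apply: IH => x /sf; exact: smooth_at_derive.
Qed.

(* The total system d F_j = sum_(l, i) Gam_(l, i, j) F_i d x_l. It
   only gives the derivatives of F along lines, so continuity has to be proved. *)
Variables (m N : nat) (F : 'I_N -> 'rV[R]_m -> R).
Variables (Gam : 'I_m -> 'I_N -> 'I_N -> 'rV[R]_m -> R) (A : set 'rV[R]_m).
Hypothesis oA : open A.
Hypothesis sGam : forall l i j k, class_C k (Gam l i j) A.
Hypothesis dF : forall j x v, A x ->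
  is_derive x v (F j) (\sum_l v 0 l * \sum_i F i x * Gam l i j x).

Lemma linear_system_bound (C : R) (x w : 'rV[R]_m) j :
  (forall l i, `|Gam l i j x| <= C) ->
  `|\sum_l w 0 l * \sum_i F i x * Gam l i j x| <=
  `|w| * (m%:R * C * \sum_i `|F i x|).
Proof.
move=> GC; apply: (le_trans (ler_norm_sum _ _ _)).
apply: (@le_trans _ _ (\sum_(l < m) `|w| * (C * \sum_i `|F i x|))).
  apply: ler_sum => l _; rewrite normrM; apply: ler_pM => //.
    by rewrite [leRHS]mx_normrE; exact: (le_bigmax _ _ (0, l)).
  apply: (le_trans (ler_norm_sum _ _ _)); rewrite mulr_sumr.
  by apply: ler_sum => i _; rewrite normrM mulrC ler_wpM2r.
by rewrite sumr_const card_ord -[leLHS]mulr_natl mulrCA !mulrA.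
Qed.

(** Let S s be the largest value of the sum of the |F_i| on the segment from x
    to x + w. By the mean value theorem no F_i varies by more than `|w| * (m%:R
    * C * S s) on it. Adding these up, S s is at most its value at x plus half
    of S s, so at most twice its value at x. *)
Lemma linear_system_growth (C r : R) (x w : 'rV[R]_m) : 0 <= C ->
  (forall y, ball_ Num.norm x r y -> A y /\ forall l i j, `|Gam l i j y| <= C) ->
  `|w| < r -> N%:R * (`|w| * (m%:R * C)) <= 2^-1 ->
  forall j, `|F j (x + w) - F j x| <= `|w| * (m%:R * C * (2 * \sum_i `|F i x|)).
Proof.
move=> C0 rP wr wsmall.
have seg (t : R) : 0 <= t <= 1 -> A (x + t *: w) /\
    forall l i j, `|Gam l i j (x + t *: w)| <= C.
  move=> /andP[t0 t1]; apply: rP; rewrite /ball_ /= opprD addrA subrr add0r normrN.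
  by rewrite normrZ ger0_norm // (le_lt_trans _ wr) // ler_piMl.
pose S (t : R) : R := \sum_i `|F i (x + t *: w)|.
have cS : {within `[0, 1], continuous S}.
  pose B := (fun s : R => x + s *: w) @^-1` A.
  have cl : continuous (fun s : R => x + s *: w).
    by move=> s; exact/smooth_at_cont/smooth_at_line.
  have oB : open B by exact: open_comp.
  have CS : class_C 0 S B.
    apply: class_C_sum => // i t At; apply: (@continuous_comp _ _ _ _ (@Num.norm _ R)).
      have /is_derive_lineP[/derivable1_diffP dFt _] := dF i w At.
      exact: differentiable_continuous dFt.
    exact: norm_continuous.
  apply: continuous_in_subspaceT => t; rewrite inE /= in_itv /= => t01.
  by apply: CS; have [] := seg t t01.
have [s s01 smax] := EVT_max ler01 cS.
have incr j (t : R) : 0 <= t <= 1 ->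
    `|F j (x + t *: w) - F j x| <= `|w| * (m%:R * C * S s).
  move=> /andP[t0 t1].
  have seg' u : 0 <= u <= t -> 0 <= u <= 1.
    by move=> /andP[u0 ut]; rewrite u0 (le_trans ut).
  have [u /seg' /seg [Au _]|u /seg' u01 ->] := @directional_MVT _ _ (F j) x w t t0.
    by have [] := dF j w Au.
  have [Au GC] := seg u u01; have [_ ->] := dF j w Au.
  rewrite normrM (ger0_norm t0).
  apply: (@le_trans _ _ (1 * (`|w| * (m%:R * C * S s)))); last by rewrite mul1r.
  apply: ler_pM => //; apply: (le_trans (linear_system_bound w (fun l i => GC l i j))).
  apply: ler_wpM2l => //; apply: ler_wpM2l; first by rewrite mulr_ge0.
  by apply: smax; rewrite in_itv.
have S2 : S s <= 2 * \sum_i `|F i x|.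
  have : S s <= \sum_i (`|F i x| + `|w| * (m%:R * C * S s)).
    apply: ler_sum => i _; rewrite in_itv /= in s01.
    by apply: le_trans (lerD (lexx _) (incr i s s01)); rewrite -lerBlDl lerB_dist.
  rewrite big_split /= sumr_const card_ord -[X in _ + X]mulr_natl.
  have S0 : 0 <= S s by apply: sumr_ge0.
  have := ler_wpM2r S0 wsmall; rewrite -!mulrA.
  set q := N%:R * _; set T := \sum_i _; move: (S s) => z; lra.
move=> j; have := incr j 1; rewrite scale1r lexx ler01 => /(_ isT) /le_trans; apply.
by apply: ler_wpM2l => //; apply: ler_wpM2l => //; rewrite mulr_ge0.
Qed.

Lemma linear_system_continuous j x : A x -> {for x, continuous (F j)}.
Proof.
move=> Ax; pose G (t : 'I_m * 'I_N * 'I_N) := Gam t.1.1 t.1.2 t.2.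
pose C : R := 1 + \sum_t `|G t x|.
have C0 : 0 <= C by rewrite addr_ge0 // sumr_ge0.
have near_t t : \forall y \near x, `|G t y| <= C.
  have cG : {for x, continuous (G t)} by exact: (class_C_cont (sGam _ _ _ 0%N) Ax).
  have Gx1 : `|G t x| + 1 <= C.
    by rewrite addrC /C (bigD1 t) //= addrA lerDl sumr_ge0.
  have /cvgrPdist_lt /(_ 1 ltr01) := cG; apply: filterS => y xy.
  apply: le_trans Gx1; rewrite -[G t y](subKr (G t x)).
  by apply: le_trans (ler_normB _ _) _; rewrite lerD2l ltW.
have : \forall y \near x, A y /\ forall t, `|G t y| <= C.
  by apply: filterI; [exact: open_nbhs_nbhs|exact: filter_forall near_t].
move=> /nbhs_normP[r /= r0 rP].
have rP' y : ball_ Num.norm x r y -> A y /\ forall l i j, `|Gam l i j y| <= C.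
  by move=> /rP[Ay GC]; split=> // l i k; exact: (GC (l, i, k)).
suff H : forall e : R, 0 < e -> \forall y \near x, `|F j x - F j y| < e.
  by have /cvgrPdist_lt := H.
move=> e e0.
pose K1 := N%:R * (m%:R * C) + 1; pose K2 := m%:R * C * (2 * \sum_i `|F i x|) + 1.
have K10 : 0 < K1 by rewrite ltr_wpDl // !mulr_ge0.
have K20 : 0 < K2 by rewrite ltr_wpDl // !mulr_ge0 // sumr_ge0.
apply/nbhs_normP; exists (Num.min r (Num.min (2^-1 / K1) (e / K2))).
  by rewrite /= !lt_min r0 !divr_gt0.
move=> y /=; rewrite !lt_min ltr_pdivlMr // ltr_pdivlMr // distrC => /and3P[yr y1 y2].
have yE : y = x + (y - x) by rewrite addrC subrK.
rewrite distrC [X in F j X]yE; apply: le_lt_trans (linear_system_growth C0 rP' yr _ j) _.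
  rewrite mulrCA; apply: le_trans (ltW y1).
  by rewrite ler_wpM2l // /K1 lerDl.
by apply: le_lt_trans y2; rewrite ler_wpM2l // /K2 lerDl.
Qed.

(** If all F_j are of class C^k then so are the right-hand sides, which are
    their derivatives. *)
Lemma linear_system_smooth j k : class_C k (F j) A.
Proof.
elim: k j => [|k IH] j; first by move=> x Ax; exact: linear_system_continuous.
split=> [x|v].
  apply: (differentiable_of_directional (G := fun l x => \sum_i F i x * Gam l i j x)) => //.
  - move=> l y Ay; have Cs : class_C 0 (fun x => \sum_i F i x * Gam l i j x) A.
      apply: class_C_sum => // i; apply: class_CM => //.
      by move=> z Az; exact: linear_system_continuous.
    exact: Cs.
  - by move=> y v Ay; have [] := dF j v Ay.
apply: (@class_C_congr _ _ _ _ (fun x => \sum_l v 0 l * \sum_i F i x * Gam l i j x)) => //.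
  by move=> x Ax; have [_ ->] := dF j v Ax.
apply: class_C_sum => // l; apply: class_CM => //; first exact: class_C_cst.
by apply: class_C_sum => // i; exact: class_CM.
Qed.

End LinearSystems.

(** * Extension of a tangent vector by parallel transport *)

Lemma delta_sum (R : pzRingType) m (l : 'I_m) (G : 'I_m -> R) :
  \sum_k (delta_mx 0 l : 'rV[R]_m) 0 k * G k = G l.
Proof.
rewrite (bigD1 l) //= big1 => [|k /negPf kl]; last by rewrite mxE kl andbF mul0r.
by rewrite addr0 mxE !eqxx mul1r.
Qed.

Section ParallelExtension.
Context {R : realType} {m : nat} {M : manifold R m} (D : connection M).
Hypothesis M_connected : connected [set: M].
Hypothesis holonomy : trivial_holonomy D.
Variables (p0 : M) (e : tangent p0).
Implicit Types (c : chart R m M) (p q : M).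

Lemma parallel_extension_ex q : exists v : tangent q,
  exists gs, transported D gs (tpoint e) (tpoint v).
Proof.
have [gs pgs] := connected_reachable p0 q M_connected.
by have [v H] := transported_exists holonomy e pgs; exists v, gs.
Qed.

(** The vector field of the transports of e along paths from p0; the path does
    not matter, by parallel_extension_unique. *)
Definition parallel_extension : vfield M := fun q => sval (cid (parallel_extension_ex q)).

Lemma parallel_extension_reach q :
  exists gs, transported D gs (tpoint e) (tpoint (parallel_extension q)).
Proof. by rewrite /parallel_extension; case: cid. Qed.

Lemma parallel_extension_unique gs q (v : tangent q) :
  transported D gs (tpoint e) (tpoint v) -> v = parallel_extension q.
Proof.
move=> H; have [gs' H'] := parallel_extension_reach q.
exact: transported_unique H H'.
Qed.

Lemma parallel_extension_start : parallel_extension p0 = e.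
Proof. exact/esym/(@parallel_extension_unique [::]). Qed.

(** A path from p0 to g 0 followed by g on [0, t], reparametrized by [0, 1],
    transports e to V t. *)
Lemma parallel_extension_along (g : R -> M) : smooth_curve g ->
  exists2 V : forall t, tangent (g t), parallel_along D V &
    forall t, 0 <= t <= 1 -> V t = parallel_extension (g t).
Proof.
move=> sg; have [gs H] := parallel_extension_reach (g 0).
have pg : piecewise_smooth_path [:: g] (g 0) (g 1) by [].
have [v [V [_ pV V0 _]]] := transported_exists holonomy (parallel_extension (g 0)) pg.
exists V => // t t01; apply: (@parallel_extension_unique (gs ++ [:: affine_curve t 0 g])).
apply/transported_cat; exists (tpoint (parallel_extension (g 0))); split=> //=.
have st s : 0 <= s <= 1 -> 0 <= t * s + 0 <= 1.
  by rewrite addr0; case/andP: t01 => t0 t1 /andP[s0 s1]; rewrite mulr_ge0 //= mulr_ile1.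
exists (fun s => V (t * s + 0)); split.
- by move=> s s01; apply: smooth_affine_curve; exact/sg/st.
- exact: parallel_affine.
- by rewrite V0; apply: tpoint_curve; rewrite mulr0 addr0.
- have tE : t * 1 + 0 = t by rewrite mulr1 addr0.
  exact: (@tpoint_curve _ _ _ g V _ _ tE).
Qed.

Section InChart.
Variable c : chart R m M.
Hypothesis sc : smooth_chart c.

Definition extension_coord (j : 'I_m) (x : 'rV[R]_m) : R :=
  parallel_extension (chart_inv c x) (chart_coord c j).

Definition christoffel (l i j : 'I_m) (x : 'rV[R]_m) : R :=
  D (chart_inv c x) (partial_field c l (chart_inv c x)) (partial_field c i)
    (chart_coord c j).

Lemma christoffel_smooth l i j k : class_C k (christoffel l i j) (chart_image c).
Proof.
apply: class_C_of_smooth_at => x /chart_imageP[cq E].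
have sl : smooth_vfield_at (partial_field c l) (chart_inv c x).
  exact: smooth_chart_tangent.
have si : smooth_vfield_at (partial_field c i) (chart_inv c x).
  exact: smooth_chart_tangent.
have := nabla_smooth D sl si (smooth_chart_coord j sc cq).
by move=> /(smooth_fun_chart _ sc cq); rewrite E.
Qed.

Lemma velocity_chart_line (y w : 'rV[R]_m) (t : R) l :
  chart_image c (y + t *: w) ->
  velocity (fun s : R => chart_inv c (y + s *: w)) t (chart_coord c l) = w 0 l.
Proof.
move=> gy; have [cq E] := chart_imageP gy.
have sg := chart_segment_smooth sc gy.
have [_ <-] := is_derive_curve sg (smooth_chart_coord l sc cq).
have near_line : {near t, (fun s : R => y 0 l + s * w 0 l) =1
    chart_coord c l \o (fun s : R => chart_inv c (y + s *: w))}.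
  have cl := smooth_at_cont (smooth_at_line y w t).
  have := near_chart_invK cq; rewrite E => /cl H.
  have {}H : \forall s \near t, chart_dom c (chart_inv c (y + s *: w)) /\
    c (chart_inv c (y + s *: w)) = y + s *: w := H.
  by apply: filterS H => s [_ Es]; rewrite /chart_coord /= Es !mxE.
rewrite -(near_eq_derive _ near_line).
have -> : (fun s : R => y 0 l + s * w 0 l) = (fun s => w 0 l * s + y 0 l).
  by apply/funext => s; rewrite addrC mulrC.
have -> : 'D_1 (fun s : R => w 0 l * s + y 0 l) t =
    w 0 l *: 'D_1 id (w 0 l * t + y 0 l).
  by apply: derive_affine; exact: ex_diff.
by rewrite derive_id; exact: mulr1.
Qed.

(** On a segment in the chart the extension is a parallel field along a curve,
    so its components satisfy the linear equation of parallel transport. The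
    point x is taken as the midpoint of the segment, so that the derivative at x
    is two-sided. *)
Lemma extension_coord_derive j x (v : 'rV[R]_m) : chart_image c x ->
  is_derive x v (extension_coord j)
    (\sum_l v 0 l * \sum_i extension_coord i x * - christoffel l i j x).
Proof.
move=> gx; have [cq E] := chart_imageP gx.
have [r r0 rP] := chart_ball cq; rewrite E in rP.
(* The factor h keeps the segment from x - h *: v to x + h *: v in the ball. *)
pose h := r / (`|v| + 1); have v10 : 0 < `|v| + 1 by rewrite ltr_wpDl.
have h0 : 0 < h by rewrite divr_gt0.
have hv : `|h *: v| < r.
  by rewrite normrZ gtr0_norm // /h -mulrA gtr_pMr // mulrC ltr_pdivrMr // mul1r ltrDl.
pose y := x - h *: v; pose w := (2 * h) *: v.
have yw t : y + t *: w = x + (t * 2 - 1) *: (h *: v).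
  by apply/rowP => i; rewrite !mxE; ring.
have gyw t : 0 <= t <= 1 -> chart_image c (y + t *: w).
  move=> t01; apply: rP; have -> : w = (x + h *: v) - y.
    by apply/rowP => i; rewrite !mxE; ring.
  apply: ball_segment => //; rewrite /ball_ /=.
    by rewrite /y opprD opprK addrA subrr add0r.
  by rewrite opprD addrA subrr add0r normrN.
pose g (s : R) := chart_inv c (y + s *: w).
have sg : smooth_curve g by move=> t /gyw; exact: chart_segment_smooth.
have [V pV VE] := parallel_extension_along sg.
pose t : R := 2^-1.
have t01 : 0 <= t <= 1 by apply/andP; split; rewrite /t; lra.
have xt : x = y + t *: w by rewrite yw /t mulVf ?pnatr_eq0 // subrr scale0r addr0.
have gt := gyw t t01; have [cgt _] := chart_imageP gt.
have dV := covariant_derivative_coord j sc cgt (sg t t01) (pV t t01).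
have nV : {near t, (fun s => V s (chart_coord c j)) =1 (fun s => extension_coord j (y + s *: w))}.
  have : \forall s \near t, 0 <= s <= 1.
    apply/nbhs_normP; exists (2^-1); first by rewrite /= invr_gt0.
    by move=> s /=; rewrite ltr_distl /t => /andP[a b]; apply/andP; split; lra.
  by apply: filterS => s s01; rewrite VE.
have := near_eq_is_derive nV dV => /is_derive_lineP.
have -> : v = (2 * h)^-1 *: w.
  by rewrite /w scalerA mulVf ?scale1r // mulf_neq0 ?pnatr_eq0 ?gt_eqF.
rewrite -xt => /(is_derive_scaled_direction (2 * h)^-1) dd; apply: (is_derive_eq dd).
rewrite tangent_val0 sub0r VE //.
have velE : velocity g t = \sum_l w 0 l *: partial_field c l (g t).
  rewrite [LHS](tangent_partialE _ sc cgt); apply: eq_bigr => l _.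
  by rewrite velocity_chart_line.
have GE i : D (g t) (velocity g t) (partial_field c i) (chart_coord c j) =
    \sum_l w 0 l * christoffel l i j x.
  rewrite velE nabla_suml; last exact: smooth_chart_tangent.
  rewrite tangent_val_sum; apply: eq_bigr => l _.
  by rewrite tangent_valZ /christoffel xt.
have FE i : parallel_extension (g t) (chart_coord c i) = extension_coord i x.
  by rewrite /extension_coord xt.
under eq_bigr => i _ do rewrite GE FE mulr_sumr.
rewrite exchange_big -sumrN mulr_sumr; apply: eq_bigr => l _.
have S1 : \sum_i extension_coord i x * (w 0 l * christoffel l i j x) =
    w 0 l * \sum_i extension_coord i x * christoffel l i j x.
  by rewrite mulr_sumr; apply: eq_bigr => i _; rewrite mulrCA.
have S2 : \sum_i extension_coord i x * - christoffel l i j x =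
    - \sum_i extension_coord i x * christoffel l i j x.
  by rewrite -sumrN; apply: eq_bigr => i _; rewrite mulrN.
have Sw : ((2 * h)^-1 *: w) 0 l = (2 * h)^-1 * w 0 l by rewrite [LHS]mxE.
rewrite Sw -mulrA; congr (_ * _).
by rewrite S2 mulrN -S1.
Qed.

Lemma extension_coord_smooth j x : chart_image c x -> smooth_at (extension_coord j) x.
Proof.
move=> gx; exists (chart_image c); split=> //; first exact: chart_im_open.
apply: (linear_system_smooth (Gam := fun l i j x => - christoffel l i j x)).
- exact: chart_im_open.
- move=> l i j' k; under eq_fun do rewrite -mulN1r.
  apply: class_CM; [exact: chart_im_open|exact: class_C_cst|exact: christoffel_smooth].
- by move=> j' y v; exact: extension_coord_derive.
Qed.

End InChart.

Lemma parallel_extension_smooth : smooth_vfield parallel_extension.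
Proof.
move=> p; have [c ac cp] := atlas_cover p; have sc := atlas_smooth_chart ac.
apply: (smooth_vfield_chart sc cp) => j; apply/(smooth_fun_chart _ sc cp).
by apply: (extension_coord_smooth sc j); exists p.
Qed.

(** The derivatives of the components found along segments are exactly those
    which the expression of the connection in the chart requires. *)
Lemma parallel_extension_parallel p (v : tangent p) : D p v parallel_extension = 0.
Proof.
have [c ac cp] := atlas_cover p; have sc := atlas_smooth_chart ac.
have gp : chart_image c (c p) by exists p.
apply: (tangent_eqP sc cp) => j.
rewrite (nabla_chartE D v j sc cp (@parallel_extension_smooth p)) tangent_val0.
rewrite (tangent_chartE v sc cp); last first.
  exact: smooth_vfield_coord (@parallel_extension_smooth p).
have dE l : 'D_(delta_mx 0 l) (extension_coord c j) (c p) =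
    - \sum_i parallel_extension p (chart_coord c i) * christoffel c l i j (c p).
  have [_ ->] := extension_coord_derive sc j (delta_mx 0 l) gp.
  rewrite delta_sum -sumrN; apply: eq_bigr => i _.
  by rewrite /extension_coord chart_mapK // mulrN.
rewrite (eq_bigr _ (fun l _ => congr1 _ (dE l))).
have GE i : D p v (partial_field c i) (chart_coord c j) =
    \sum_l v (chart_coord c l) * christoffel c l i j (c p).
  rewrite [in LHS](tangent_partialE v sc cp) nabla_suml; last exact: smooth_chart_tangent.
  rewrite tangent_val_sum; apply: eq_bigr => l _.
  by rewrite tangent_valZ /christoffel chart_mapK.
under [X in _ + X]eq_bigr => i _ do rewrite GE mulr_sumr.
rewrite [X in _ + X]exchange_big -big_split big1 // => l _.
have S : \sum_i parallel_extension p (chart_coord c i) *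
      (v (chart_coord c l) * christoffel c l i j (c p)) =
    v (chart_coord c l) *
      \sum_i parallel_extension p (chart_coord c i) * christoffel c l i j (c p).
  by rewrite mulr_sumr; apply: eq_bigr => i _; rewrite mulrCA.
by rewrite -[LHS]/(_ + _) S mulrN addNr.
Qed.

End ParallelExtension.

(** * The bracket identities of a parallel frame *)

Section ParallelFrame.
Context {R : realType} {n : nat} {M : manifold R (n + n)} (J : almost_complex M).
Hypothesis M_connected : connected [set: M].
Hypothesis J_integrable : integrable_acs J.
Variable D : connection M.
Hypothesis D_complex : complex_connection D J.
Hypothesis holonomy : trivial_holonomy D.
Hypothesis D_torsion : torsion_type20 D J.
Implicit Types (p q : M) (X Y : vfield M).

(** The coordinate fields of the real parts of holomorphic coordinates. *)
Lemma real_frame_exists p : exists e : 'I_n -> tangent p, lin_indep (real_frame J e).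
Proof.
have [c hc cp] := J_integrable p.
exists (fun k => ztangent c p (fun j => (j == k)%:R)) => r r0.
pose a k : R[i] := (r (inl k) +i* r (inr k))%C.
have a0 : \sum_k cmul J (a k) (ztangent c p (fun j => (j == k)%:R)) = 0.
  by rewrite -[RHS]r0 big_sumType /= -big_split.
have ak k : a k = 0.
  have := congr1 (fun v => cderiv v (zcoord c k)) a0.
  rewrite /= (cderiv_frame _ _ _ hc cp) cderiv0l (bigD1 k) //= big1 => [|l /negPf lk].
    by rewrite addr0 ztangentE ?eqxx ?mulr1 //; exact: hc.1.
  by rewrite ztangentE 1?eq_sym ?lk ?mulr0 //; exact: hc.1.
by case=> k; have /eqP := ak k; rewrite eq_complex /= => /andP[/eqP ? /eqP ?].
Qed.

Lemma parallel_Jfield X : smooth_vfield X ->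
  (forall p (v : tangent p), D p v X = 0) ->
  forall p (v : tangent p), D p v (Jfield J X) = 0.
Proof. by move=> sX X0 p v; rewrite D_complex // X0 linear0. Qed.

Lemma parallel_torsion X Y p : (forall q (v : tangent q), D q v X = 0) ->
  (forall q (v : tangent q), D q v Y = 0) ->
  torsion D X Y p = - lie_bracket X Y p.
Proof. by move=> X0 Y0; rewrite /torsion X0 Y0 subrr sub0r. Qed.

(** The torsion of parallel fields is the opposite of their bracket. *)
Lemma parallel_bracket_J X Y p : smooth_vfield X -> smooth_vfield Y ->
  (forall q (v : tangent q), D q v X = 0) ->
  (forall q (v : tangent q), D q v Y = 0) ->
  lie_bracket (Jfield J X) Y p = J p (lie_bracket X Y p).
Proof.
move=> sX sY X0 Y0; have := D_torsion (sX p) (sY p).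
rewrite !parallel_torsion //; last exact: parallel_Jfield.
by rewrite linearN => /oppr_inj.
Qed.

Lemma parallel_bracket_JJ X Y p : smooth_vfield X -> smooth_vfield Y ->
  (forall q (v : tangent q), D q v X = 0) ->
  (forall q (v : tangent q), D q v Y = 0) ->
  lie_bracket X Y p = - lie_bracket (Jfield J X) (Jfield J Y) p.
Proof.
move=> sX sY X0 Y0.
have sJ Z : smooth_vfield Z -> smooth_vfield (Jfield J Z).
  by move=> sZ q; exact: acs_smooth.
have JY0 := parallel_Jfield sY Y0.
rewrite parallel_bracket_J //; last exact: sJ.
rewrite (lie_bracketC (sX p) (sJ _ sY p)) parallel_bracket_J //.
by rewrite linearN acs_sqr !opprK (lie_bracketC (sY p) (sX p)) opprK.
Qed.

Lemma frame_of_flat_connection : exists X : 'I_n -> vfield M,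
  [/\ forall k, smooth_vfield (X k),
      forall p : M, lin_indep (fun k : 'I_n + 'I_n =>
        match k with inl k => X k p | inr k => Jfield J (X k) p end),
      forall k l : 'I_n, (k < l)%N -> forall p : M,
        lie_bracket (X k) (X l) p
        = - lie_bracket (Jfield J (X k)) (Jfield J (X l)) p
    & forall k l : 'I_n, (k <= l)%N -> forall p : M,
        lie_bracket (Jfield J (X k)) (X l) p = J p (lie_bracket (X k) (X l) p)].
Proof.
have [[p0 _]|noM] := pselect (exists p : M, True); last first.
  (* On the empty manifold any fields will do. *)
  by exists (fun _ _ => 0); split=> [k p|p|k l _ p|k l _ p]; case: noM; exists p.
have [e ie] := real_frame_exists p0.
pose X k := parallel_extension M_connected holonomy (e k).
have sX k : smooth_vfield (X k) by exact: parallel_extension_smooth.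
have X0 k p (v : tangent p) : D p v (X k) = 0 by exact: parallel_extension_parallel.
exists X; split => // [q r r0|k l _ p|k l _ p].
(* A relation at q extends to a parallel field; as it vanishes at q it vanishes
   at p0, where the frame is independent. *)
- pose W k : vfield M := match k with inl k => X k | inr k => Jfield J (X k) end.
  have sW k : smooth_vfield (W k).
    by case: k => k //= p; apply: acs_smooth; exact: sX.
  have W0 k p (v : tangent p) : D p v (W k) = 0.
    by case: k => k /=; [exact: X0|apply: parallel_Jfield => //; exact: X0].
  pose Y : vfield M := fun p => \sum_k r k *: W k p.
  have sY : smooth_vfield Y.
    move=> p; apply: smooth_vfield_sum => k.
    by apply: smooth_vfieldM; [exact: smooth_fun_cst|exact: sW].
  have Y0 p (v : tangent p) : D p v Y = 0.
    have -> : D p v Y = \sum_k (v (fun=> r k) *: W k p + r k *: D p v (W k)).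
      apply: (nabla_sum_leibniz D v _ (f := fun k (_ : M) => r k)) => k.
        exact: smooth_fun_cst.
      exact: sW.
    by rewrite big1 // => k _; rewrite tangent_cst scale0r add0r W0 scaler0.
  have Yq : Y q = 0 by rewrite -[RHS]r0; apply: eq_bigr => -[].
  have [gs pgs] := connected_reachable p0 q M_connected.
  have Yp := parallel_field_eq0 holonomy sY Y0 pgs Yq.
  apply: ie; rewrite -[RHS]Yp; apply: eq_bigr => -[] k _ /=;
    by rewrite /Jfield /X parallel_extension_start.
- by apply: parallel_bracket_JJ => //; exact: X0.
- by apply: parallel_bracket_J => //; exact: X0.
Qed.

End ParallelFrame.

(** * The equivalence *)

Theorem proposition3p4 (R : realType) (n : nat) (M : manifold R (n + n))
    (J : almost_complex M) (M_connected : connected [set: M])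
    (J_integrable : integrable_acs J) :
  [<->
    (exists X : 'I_n -> vfield M,
      [/\ forall k, smooth_vfield (X k),
          forall p : M, lin_indep (fun k : 'I_n + 'I_n =>
            match k with inl k => X k p | inr k => Jfield J (X k) p end),
          forall k l : 'I_n, (k < l)%N -> forall p : M,
            lie_bracket (X k) (X l) p
            = - lie_bracket (Jfield J (X k)) (Jfield J (X l)) p
        & forall k l : 'I_n, (k <= l)%N -> forall p : M,
            lie_bracket (Jfield J (X k)) (X l) p
            = J p (lie_bracket (X k) (X l) p)]);
    (exists Z : 'I_n -> cvfield M,
      (forall k, holomorphic_vfield J (Z k)) /\
      (forall p : M, lin_indep (fun k => Z k p)));
    (exists alpha : 'I_n -> cform1 M,
      [/\ forall k, holomorphic_form J (alpha k),
          forall (p : M) (a : 'I_n -> R[i]),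
            (forall z : ctangent p, \sum_k a k * alpha k p z = 0) ->
            forall k, a k = 0
        & forall k, d_type20 J (alpha k)]);
    (exists D : connection M,
      [/\ complex_connection D J, trivial_holonomy D
        & torsion_type20 D J])].
Proof.
tfae.
- move=> [X [sX iX H1 H2]].
  exact: (holomorphic_fields_of_frame sX iX H1 H2).
- move=> [Z [hZ iZ]].
  have [alpha [alpha_hol alpha_indep]] := holomorphic_coframe_of_fields J_integrable hZ iZ.
  exists alpha; split=> // k; exact: holomorphic_form_d_type20.
- move=> [alpha [alpha_hol alpha_indep d20]].
  exists (coframe_connection J_integrable alpha_hol alpha_indep); split.
  + exact: coframe_connection_complex.
  + exact: coframe_connection_holonomy.
  + exact: coframe_connection_torsion.
- move=> [D [cD hD tD]].
  exact: (frame_of_flat_connection M_connected J_integrable cD hD tD).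
Qed.
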